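(* Let $n\ge 2$ and $a>0$, and let $(\theta,\phi,\tau)$ have the joint distribution defined by the hierarchy: $\phi=(\phi_1,\dots,\phi_n)\sim\mathrm{Dir}(a,\dots,a)$ and $\tau\sim\mathrm{gamma}(na,1/2)$ independent, and, given $(\phi,\tau)$, $\theta_1,\dots,\theta_n$ independent with $\theta_j\mid\phi,\tau\sim\mathrm{DE}(\phi_j\tau)$. Then the conditional distribution of $\phi$ given $\theta$ (with $\tau$ integrated out) is the same as the distribution of $(T_1/T,\dots,T_n/T)$, where $T_1,\dots,T_n$ are independent with $T_j\sim\mathrm{giG}(a-1,1,2|\theta_j|)$, and $T=\sum_{j=1}^nT_j$.
   Context: $\mathrm{DE}(s)$ is the law on $\mathbb{R}$ with density $(2s)^{-1}e^{-|x|/s}$. $\mathrm{gamma}(\alpha,1/2)$ is the gamma law with shape $\alpha$ and rate $1/2$. $\mathrm{Dir}(a,\dots,a)$ is the symmetric Dirichlet law on the simplex $\{x\in\mathbb{R}^n:x_j\ge0,\ \sum_jx_j=1\}$. The generalized inverse Gaussian law $\mathrm{giG}(\lambda,\rho,\chi)$ has density $f(y)\propto y^{\lambda-1}e^{-0.5(\rho y+\chi/y)}$ for $y>0$. Conditional distributions given $\theta$ are understood for almost every $\theta$ (in particular all $\theta_j\neq0$). *)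

(* Defs.v *)
From HB Require Import structures.
From mathcomp Require Import all_boot all_order all_algebra.
From mathcomp Require Import all_classical all_reals all_analysis.
Import Order.TTheory GRing.Theory Num.Theory.
Import numFieldNormedType.Exports.

Set Implicit Arguments.
Unset Strict Implicit.
Unset Printing Implicit Defensive.

Local Open Scope classical_set_scope.
Local Open Scope ring_scope.

(* Product of n measures, as a measure on n-tuples: the binary product of the
   first one with the product of the others, transported along cons. *)
Fixpoint tuple_product d (T : measurableType d) (R : realType) (n : nat) :
    ('I_n -> set T -> \bar R) -> set (n.-tuple T) -> \bar R :=
  match n with
  | 0 => fun _ => @dirac _ (0.-tuple T) [tuple] R
  | n'.+1 => fun m =>
      pushforward (m ord0 \x tuple_product (fun i => m (lift ord0 i)))%E
        (fun xt : T * n'.-tuple T => [tuple of xt.1 :: xt.2])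
  end.

(* [k] is a version of the conditional law of [Y] given [X]. *)
Definition conditional_law d d1 d2 (Omega : measurableType d)
    (T1 : measurableType d1) (T2 : measurableType d2) (R : realType)
    (P : probability Omega R) (X : Omega -> T1) (Y : Omega -> T2)
    (k : T1 -> set T2 -> \bar R) : Prop :=
  forall (A : set T1) (B : set T2), measurable A -> measurable B ->
    P (X @^-1` A `&` Y @^-1` B) = (\int[P]_(w in X @^-1` A) k (X w) B)%E.

Definition independent_pair d d1 d2 (Omega : measurableType d)
    (T1 : measurableType d1) (T2 : measurableType d2) (R : realType)
    (P : probability Omega R) (X : Omega -> T1) (Y : Omega -> T2) : Prop :=
  forall (A : set T1) (B : set T2), measurable A -> measurable B ->
    P (X @^-1` A `&` Y @^-1` B) = (P (X @^-1` A) * P (Y @^-1` B))%E.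

Definition has_law d d1 (Omega : measurableType d) (T : measurableType d1)
    (R : realType) (P : probability Omega R) (X : Omega -> T)
    (law : set T -> \bar R) : Prop :=
  forall A : set T, measurable A -> P (X @^-1` A) = law A.

Section laws.
Context {R : realType}.
Local Notation mu := (@lebesgue_measure R).

(* Meaningful for s > 0. *)
Definition double_exponential (s : R) (A : set R) : \bar R :=
  (\int[mu]_(x in A) ((2 * s)^-1 * expR (- `|x| / s))%:E)%E.

Definition gamma_function (alpha : R) : R :=
  \int[mu]_(x in `]0%R, +oo[) (x `^ (alpha - 1) * expR (- x)).

(* Shape alpha, rate beta. *)
Definition gamma_law (alpha beta : R) (A : set R) : \bar R :=
  (\int[mu]_(x in A `&` `]0%R, +oo[)
    (beta `^ alpha / gamma_function alpha
       * x `^ (alpha - 1) * expR (- (beta * x)))%:E)%E.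

Definition giG_weight (lambda rho chi y : R) : R :=
  y `^ (lambda - 1) * expR (- (2^-1 * (rho * y + chi / y))).

Definition giG (lambda rho chi : R) (A : set R) : \bar R :=
  (\int[mu]_(y in A `&` `]0%R, +oo[)
    (giG_weight lambda rho chi y
       / \int[mu]_(z in `]0%R, +oo[) giG_weight lambda rho chi z)%:E)%E.

Definition simplex (n : nat) : set (n.-tuple R) :=
  [set x | (forall j : 'I_n, 0 <= tnth x j) /\ \sum_(j < n) tnth x j = 1].

(* (x_1, ..., x_(n-1)) |-> (x_1, ..., x_(n-1), 1 - \sum_j x_j): the last
   coordinate is the default value of [nth]. *)
Definition simplex_chart (n : nat) (x : n.-1.-tuple R) : n.-tuple R :=
  [tuple nth (1 - \sum_(y <- x) y) x i | i < n].

(* Density with respect to Lebesgue measure in the first n - 1 coordinates. *)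
Definition symmetric_Dirichlet (n : nat) (a : R) (B : set (n.-tuple R)) :
    \bar R :=
  (\int[tuple_product (T := R) (fun _ : 'I_n.-1 => mu)]_(x in
      @simplex_chart n @^-1` (B `&` @simplex n))
    (gamma_function (n%:R * a) / gamma_function a ^+ n
       * \prod_(j < n) tnth (simplex_chart x) j `^ (a - 1))%:E)%E.

Definition normalize (n : nat) (t : n.-tuple R) : n.-tuple R :=
  [tuple tnth t j / \sum_(i < n) tnth t i | j < n].

(* Law of (T_1/T, ..., T_n/T) for independent T_j ~ giG(a-1, 1, 2|theta_j|). *)
Definition normalized_giG_law (n : nat) (a : R) (theta : n.-tuple R) :
    set (n.-tuple R) -> \bar R :=
  pushforward
    (tuple_product (fun j : 'I_n => giG (a - 1) 1 (2 * `|tnth theta j|)))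
    (@normalize n).

End laws.

(* Main.v *)
Require Import Defs.
From HB Require Import structures.
From mathcomp Require Import all_boot all_order all_algebra.
From mathcomp Require Import all_classical all_reals all_analysis.
From mathcomp Require Import measurable_realfun measurable_fun_approximation.
From mathcomp Require Import ring.
Import Order.TTheory GRing.Theory Num.Theory.
Import numFieldNormedType.Exports.

Set Implicit Arguments.
Unset Strict Implicit.
Unset Printing Implicit Defensive.

Local Open Scope classical_set_scope.
Local Open Scope ring_scope.

(** The joint law of [(theta, phi, tau)] has an explicit density.  With
    [n] coordinates it is, up to a constant,
      [tau^(n a - 1) e^(- tau / 2) \prod_j phi_j^(a - 1)
         \prod_j (phi_j tau)^(-1) e^(- |theta_j| / (phi_j tau))].
    In the variables [T_j = phi_j tau] this is
      [tau^(n - 1) \prod_j T_j^(a - 2) e^(- T_j / 2 - |theta_j| / T_j)],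
    because [phi] sums to 1, and [tau^(n - 1)] is exactly what the polar
    change of variables [T = tau phi] absorbs ([density_identity] and
    [integral_lebesgue_tuple_polar]).  The remaining product is the product of
    the unnormalized densities of [giG(a - 1, 1, 2 |theta_j|)], and [phi] is
    recovered as [T / \sum_j T_j].  Integrating [tau] out therefore gives
      [P (theta in A, phi in B) = C \int_(t in A) giG_mass a t B dt]
    ([joint_law]), where [giG_mass a t B] is the mass that this product puts on
    the [T] with [normalize T] in [B].  A conditional law of [phi] given
    [theta = t] is then the normalization of [giG_mass a t], and
    [normalized_giG_law] is the same thing coordinate by coordinate
    ([normalized_giG_lawE]).

    No gamma or Bessel integral has to be evaluated.  Since the joint law has
    mass 1, the total mass of [giG_mass a t] is finite for almost every [t];
    it is the product of the one-dimensional normalizing integrals, and a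
    product in ]0, +oo[ of nonnegative factors has only finite factors
    ([fin_num_factor]).  In the same way points with [theta_j = 0], points of
    the boundary of the simplex and the like are absorbed: the densities vanish
    there or the exceptional set is null.

    The polar formula itself is reduced by Tonelli's theorem to the behaviour
    of one-dimensional Lebesgue measure under shifts and scalings: shift the
    last coordinate so that it becomes the sum [s], exchange the integrals,
    and scale the other coordinates by [s].

    Finally, two conditional laws agree almost everywhere on each set, hence
    almost everywhere simultaneously on a countable pi-system, here the boxes
    with rational corners, hence on all measurable sets
    ([conditional_law_unique]). *)

(** * Integration against a density *)

Section density.
Local Open Scope ereal_scope.
Context d (T : measurableType d) (R : realType).
Variables m nu : {measure set T -> \bar R}.
Variable g : T -> \bar R.
Hypothesis mg : measurable_fun setT g.
Hypothesis g0 : forall x, 0 <= g x.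
Hypothesis nuE : forall A, measurable A -> nu A = \int[m]_(x in A) g x.

Import HBNNSimple.

Let integral_density_indic E : measurable E ->
  \int[nu]_x (\1_E x)%:E = \int[m]_x ((\1_E x)%:E * g x).
Proof.
move=> mE; rewrite integral_indic// setIT nuE// integral_mkcond epatch_indic.
by apply: eq_integral => x _; rewrite muleC.
Qed.

Let integral_density_nnsfun (h : {nnsfun T >-> R}) :
  \int[nu]_x (h x)%:E = \int[m]_x ((h x)%:E * g x).
Proof.
under [LHS]eq_integral do rewrite fimfunE -fsumEFin//.
rewrite [LHS]ge0_integral_fsum//; last 2 first.
  - by move=> r; exact/measurable_EFinP/measurableT_comp.
  - by move=> n x _; rewrite EFinM nnfun_muleindic_ge0.
under [RHS]eq_integral.
  move=> x xD; rewrite fimfunE -fsumEFin// ge0_mule_fsuml; last first.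
    by move=> r; rewrite EFinM nnfun_muleindic_ge0.
  over.
rewrite [RHS]ge0_integral_fsum//; last 2 first.
  - move=> r; apply: emeasurable_funM => //.
    exact/measurable_EFinP/measurableT_comp.
  - by move=> n x _; rewrite mule_ge0// EFinM nnfun_muleindic_ge0.
apply: eq_fsbigr => r _.
rewrite integralZl_indic_nnsfun//= integral_density_indic//.
have [r0|r0] := leP 0%R r.
  rewrite -ge0_integralZl//.
  - by apply: eq_integral => x _; rewrite EFinM muleA.
  - apply: emeasurable_funM => //; exact/measurable_EFinP.
  - by move=> x _; rewrite mule_ge0// lee_fin.
by rewrite preimage_nnfun0// !integral0_eq ?mule0// => x _;
  rewrite indic0 ?mulr0 mul0e.
Qed.

(** Extends [nuE] from sets to functions by approximation with simple functions.
    The density may take the value [+oo]; this is needed later, where it is a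
    marginal density that is only almost everywhere finite. *)
Lemma ge0_integral_density (f : T -> \bar R) : measurable_fun setT f ->
  (forall x, 0 <= f x) -> \int[nu]_x f x = \int[m]_x (f x * g x).
Proof.
move=> mf f0; pose f_ := nnsfun_approx measurableT mf.
have f_nd x a b : (a <= b)%N -> (f_ a x <= f_ b x)%R.
  by move=> ab; exact/lefP/nd_nnsfun_approx.
transitivity (limn (fun n => \int[nu]_x (f_ n x)%:E)).
  rewrite -monotone_convergence//=.
  - by apply: eq_integral => x _; apply/esym/cvg_lim => //=;
      exact: cvg_nnsfun_approx.
  - by move=> n; apply/measurable_EFinP.
  - by move=> n x _; rewrite lee_fin.
  - by move=> x _ a b ab; rewrite lee_fin f_nd.
transitivity (limn (fun n => \int[m]_x ((f_ n x)%:E * g x))).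
  by congr (limn _); apply/funext => n; exact: integral_density_nnsfun.
rewrite -monotone_convergence//=.
- apply: eq_integral => x _; apply/cvg_lim => //=.
  have cf : (f_ n x)%:E @[n --> \oo] --> f x.
    by apply: cvg_nnsfun_approx => // t _.
  have [gfin|] := boolP (g x \is a fin_num); first exact: cvgeZr.
  rewrite ge0_fin_numE// -leNgt leye_eq => /eqP ->.
  have [[k fk]|f_0] := pselect (exists k, (0 < f_ k x)%R).
    have fx0 : 0 < f x.
      have <- : ereal_sup (range (fun n => (f_ n x)%:E)) = f x.
        apply: (cvg_unique _ _ cf) => //; apply: ereal_nondecreasing_cvgn.
        by move=> a b ab; rewrite lee_fin f_nd.
      apply: (@lt_le_trans _ _ (f_ k x)%:E); first by rewrite lte_fin.
      by apply: ereal_sup_ubound; exists k.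
    rewrite gt0_muley//; apply: cvg_near_cst.
    exists k => // n /= kn; rewrite gt0_muley// lte_fin.
    exact: lt_le_trans fk (f_nd _ _ _ kn).
  have {}f_0 n : f_ n x = 0%R.
    apply/eqP; rewrite eq_le fun_ge0 andbT leNgt; apply/negP => fn0.
    by apply: f_0; exists n.
  have <- : 0 = f x.
    apply: (cvg_unique _ _ cf) => //.
    rewrite (_ : (fun _ => _) = cst 0); first exact: cvg_cst.
    by apply/funext => n; rewrite f_0.
  rewrite mul0e (_ : (fun _ => _) = cst 0); first exact: cvg_cst.
  by apply/funext => n; rewrite f_0 mul0e.
- by move=> n; apply: emeasurable_funM => //; exact/measurable_EFinP.
- by move=> n x _; rewrite mule_ge0// lee_fin.
- by move=> x _ a b ab; rewrite lee_pmul// ?lee_fin// f_nd.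
Qed.

End density.

(** * Lebesgue measure on tuples *)

Section measure_packing.
Local Open Scope ereal_scope.
Context d (T : measurableType d) (R : realType).

(** Lets a set function that is only known as a term be used as a measure,
    whose equation with the original function is kept for rewriting. *)
Lemma measure_of (m : set T -> \bar R) : m set0 = 0 -> (forall A, 0 <= m A) ->
  semi_sigma_additive m ->
  {M : {measure set T -> \bar R} | (M : set T -> \bar R) = m}.
Proof.
move=> m0 m_ge0 m_add.
pose mx := isMeasure.Build d T R m m0 m_ge0 m_add.
pose M : {measure set T -> \bar R} := HB.pack m mx.
by exists M.
Qed.

Lemma sigma_finite_measure_of (m : {measure set T -> \bar R}) :
  sigma_finite setT m ->
  {M : {sigma_finite_measure set T -> \bar R} |
    (M : set T -> \bar R) = m}.
Proof.
case: m => m mc ms.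
pose mx := Measure_isSigmaFinite.Build d T R (Measure.Pack mc) ms.
pose M : {sigma_finite_measure set T -> \bar R} := HB.pack m mc mx.
by exists M.
Qed.

End measure_packing.

Lemma measurable_preimage d1 d2 (T1 : measurableType d1)
    (T2 : measurableType d2) (f : T1 -> T2) A :
  measurable_fun setT f -> measurable A -> measurable (f @^-1` A).
Proof. by move=> mf mA; rewrite -[X in measurable X]setTI; exact: mf. Qed.

Lemma pushforward_measure_of d1 d2 (T1 : measurableType d1)
    (T2 : measurableType d2) (R : realType) (m : {measure set T1 -> \bar R})
    (f : T1 -> T2) : measurable_fun setT f ->
  {M : {measure set T2 -> \bar R} | (M : set T2 -> \bar R) = pushforward m f}.
Proof.
move=> mf; apply: measure_of => [|A|].
- by rewrite /pushforward preimage_set0 measure0.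
- by rewrite /pushforward; exact: measure_ge0.
- move=> F mF tF mUF; rewrite /pushforward preimage_bigcup.
  apply: measure_semi_sigma_additive.
  + by move=> k; exact: measurable_preimage.
  + apply/trivIsetP => /= i j _ _ ij; rewrite -preimage_setI.
    by move/trivIsetP : tF => /(_ _ _ _ _ ij) ->//; rewrite preimage_set0.
  + by rewrite -preimage_bigcup; exact: measurable_preimage.
Qed.

Lemma density_measure_of d (T : measurableType d) (R : realType)
    (m : {measure set T -> \bar R}) (g : T -> \bar R) :
  measurable_fun setT g -> (forall x, 0 <= g x)%E ->
  {M : {measure set T -> \bar R} |
    (M : set T -> \bar R) = (fun A => \int[m]_(x in A) g x)%E}.
Proof.
move=> mg g0; apply: measure_of => [|A|].
- by rewrite integral_set0.
- exact: integral_ge0.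
- have gadd := semi_sigma_additive_nng_induced (mu := m) mg g0.
  exact: gadd.
Qed.

Section lebR.
Local Open Scope ereal_scope.
Context {R : realType}.

(** The reals carry two measurable structures with the same measurable sets but
    distinct displays: [lebesgue_measure] is a measure for one of them, while
    tuples of reals are built on the other.  [lebR] is Lebesgue measure for the
    latter, and [integral_lebR] moves integrals between the two. *)
Definition lebR : set R -> \bar R := @lebesgue_measure R.

Let lebR_measure_sig : {M : {measure set R -> \bar R} |
  (M : set R -> \bar R) = pushforward (@lebesgue_measure R)
     (idfun : measurableTypeR R -> R)}.
Proof. by apply: pushforward_measure_of => _ A mA; rewrite setTI. Qed.

Let lebR0 : lebR set0 = 0.
Proof. by have [M ME] := lebR_measure_sig; rewrite -[lebR]ME measure0. Qed.

Let lebR_ge0 A : 0 <= lebR A.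
Proof. by have [M ME] := lebR_measure_sig; rewrite -[lebR]ME. Qed.

Let lebR_additive : semi_sigma_additive lebR.
Proof.
have [M ME] := lebR_measure_sig; rewrite -[lebR]ME.
exact: measure_semi_sigma_additive.
Qed.

HB.instance Definition _ := isMeasure.Build _ _ _ lebR
  lebR0 lebR_ge0 lebR_additive.

Let lebR_sigma_finite : sigma_finite setT lebR.
Proof. exact: (sigma_finiteT (@lebesgue_measure R)). Qed.

HB.instance Definition _ := Measure_isSigmaFinite.Build _ _ _
  lebR lebR_sigma_finite.

Lemma integral_lebR (D : set R) (f : R -> \bar R) : measurable D ->
  measurable_fun D f -> (forall x, D x -> 0 <= f x) ->
  \int[lebR]_(x in D) f x = \int[lebesgue_measure]_(x in D) f x.
Proof.
move=> mD mf f0.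
rewrite [LHS](_ : _ = \int[pushforward (@lebesgue_measure R)
     (idfun : measurableTypeR R -> R)]_(x in D) f x)//.
rewrite ge0_integral_pushforward//; first by move=> _ A mA; rewrite setTI.
by move=> y /[!inE]; exact: f0.
Qed.

End lebR.

Section lebesgue_tuple.
Local Open Scope ereal_scope.
Context {R : realType}.
Local Notation mu := (@lebR R).

Definition lebesgue_tuple n : set (n.-tuple R) -> \bar R :=
  tuple_product (T := R) (fun _ : 'I_n => mu).
Arguments lebesgue_tuple : clear implicits.

Definition cons_pair n (z : R * n.-tuple R) : n.+1.-tuple R :=
  [tuple of z.1 :: z.2].

Lemma measurable_cons_pair n : measurable_fun setT (@cons_pair n).
Proof. exact: measurable_cons. Qed.

Definition uncons n (t : n.+1.-tuple R) : R * n.-tuple R :=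
  (thead t, [tuple of behead t]).

Lemma measurable_uncons n : measurable_fun setT (@uncons n).
Proof.
apply: measurable_fun_pair; first exact: measurable_tnth.
exact: measurable_behead.
Qed.

Lemma cons_pairK n : cancel (@cons_pair n) (@uncons n).
Proof.
move=> [x t]; congr (_, _).
exact: val_inj.
Qed.

Lemma lebesgue_tuple_measure n :
  {M : {sigma_finite_measure set (n.-tuple R) -> \bar R} |
    (M : set (n.-tuple R) -> \bar R) = lebesgue_tuple n}.
Proof.
elim: n => [|n [M ME]].
  by exists (@dirac _ (0.-tuple R) [tuple] R :
    {sigma_finite_measure set _ -> \bar R}).
have [N NE] : {N : {measure set (n.+1.-tuple R) -> \bar R} |
    (N : set _ -> _) = pushforward (product_measure1 mu M) (@cons_pair n)}.
  by apply: pushforward_measure_of; exact: measurable_cons_pair.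
have [N' N'E] : {N' : {sigma_finite_measure set (n.+1.-tuple R) -> \bar R} |
    (N' : set _ -> _) = N}.
  apply: sigma_finite_measure_of.
  have /sigma_finiteP[F [FT ndF Foo]] := sigma_finiteT mu.
  have /sigma_finiteP[G [GT ndG Goo]] := sigma_finiteT M.
  exists (fun k => @uncons n @^-1` (F k `*` G k)).
    apply/seteqP; split => // t _.
    have [i _ Fi] : (\bigcup_k F k) (thead t) by rewrite -FT.
    have [j _ Gj] : (\bigcup_k G k) [tuple of behead t] by rewrite -GT.
    exists (maxn i j) => //; split.
      by move: Fi; exact/subsetPset/ndF/leq_maxl.
    by move: Gj; exact/subsetPset/ndG/leq_maxr.
  move=> k; have [mF Fk] := Foo k; have [mG Gk] := Goo k; split.
    apply: measurable_preimage; first exact: measurable_uncons.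
    exact: measurableX.
  rewrite NE /pushforward -comp_preimage (_ : _ \o _ = id); last first.
    by apply/funext => z; exact: cons_pairK.
  rewrite preimage_id product_measure1E//.
  by rewrite lte_mul_pinfty// ge0_fin_numE.
by exists N'; rewrite N'E NE ME.
Qed.

End lebesgue_tuple.
Arguments lebesgue_tuple R n _ : clear implicits.

Section lebesgue_tuple_instances.
Local Open Scope ereal_scope.
Context {R : realType}.
Variable n : nat.

Let lebesgue_tuple0 : lebesgue_tuple R n set0 = 0.
Proof.
by have [M <-] := lebesgue_tuple_measure (R := R) n; exact: measure0.
Qed.

Let lebesgue_tuple_ge0 A : 0 <= lebesgue_tuple R n A.
Proof. by have [M <-] := lebesgue_tuple_measure (R := R) n. Qed.

Let lebesgue_tuple_additive : semi_sigma_additive (lebesgue_tuple R n).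
Proof.
have [M <-] := lebesgue_tuple_measure (R := R) n.
exact: measure_semi_sigma_additive.
Qed.

HB.instance Definition _ := isMeasure.Build _ _ _ (lebesgue_tuple R n)
  lebesgue_tuple0 lebesgue_tuple_ge0 lebesgue_tuple_additive.

Let lebesgue_tuple_sigma_finite : sigma_finite setT (lebesgue_tuple R n).
Proof.
have [M <-] := lebesgue_tuple_measure (R := R) n.
exact: sigma_finiteT.
Qed.

HB.instance Definition _ := Measure_isSigmaFinite.Build _ _ _
  (lebesgue_tuple R n) lebesgue_tuple_sigma_finite.

End lebesgue_tuple_instances.

Section lebesgue_tuple_integral.
Local Open Scope ereal_scope.
Context {R : realType}.
Local Notation mu := (@lebR R).
Local Notation leb := (lebesgue_tuple R).

Lemma integral_lebesgue_tuple0 (h : 0.-tuple R -> \bar R) :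
  measurable_fun setT h -> (forall t, 0 <= h t) ->
  \int[leb 0]_t h t = h [tuple].
Proof.
move=> mh h0; rewrite [LHS](_ : _ = \int[dirac ([tuple] : 0.-tuple R)]_t h t)//.
by rewrite integral_dirac// diracT mul1e.
Qed.

Lemma integral_lebesgue_tuple_cons n (h : n.+1.-tuple R -> \bar R) :
  measurable_fun setT h -> (forall t, 0 <= h t) ->
  \int[leb n.+1]_t h t = \int[mu]_x \int[leb n]_t h (cons_pair (x, t)).
Proof.
move=> mh h0.
rewrite [LHS](_ : _ =
    \int[pushforward (mu \x leb n) (@cons_pair R n)]_t h t)//.
rewrite ge0_integral_pushforward//; last exact: measurable_cons_pair.
rewrite preimage_setT fubini_tonelli1//; last by move=> z; exact: h0.
by apply: measurableT_comp => //; exact: measurable_cons_pair.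
Qed.

Definition rcons_pair n (z : n.-tuple R * R) : n.+1.-tuple R :=
  [tuple of rcons z.1 z.2].

Lemma measurable_rcons_pair n : measurable_fun setT (@rcons_pair n).
Proof.
apply/measurable_fun_tnthP => i /=.
have [ilt|ige] := ltnP i n.
  rewrite (_ : _ \o _ = (fun t => tnth t (Ordinal ilt)) \o fst).
    by apply: measurableT_comp => //; exact: measurable_tnth.
  apply/funext => -[t y] /=.
  rewrite !(tnth_nth y) /= nth_rcons size_tuple ilt//.
rewrite (_ : _ \o _ = snd); first exact: measurable_snd.
apply/funext => -[t y] /=.
rewrite (tnth_nth y) /= nth_rcons size_tuple ltnNge ige/=.
by rewrite eqn_leq ige -ltnS ltn_ord.
Qed.

(** [tuple_product] peels off the first coordinate, whereas [simplex_chart]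
    treats the last one as special, so Tonelli is needed with the last
    coordinate innermost. *)
Lemma integral_lebesgue_tuple_rcons n (h : n.+1.-tuple R -> \bar R) :
  measurable_fun setT h -> (forall t, 0 <= h t) ->
  \int[leb n.+1]_t h t = \int[leb n]_t \int[mu]_y h (rcons_pair (t, y)).
Proof.
elim: n h => [|n IHn] h mh h0.
  rewrite integral_lebesgue_tuple_cons//.
  have mF (k : 0.-tuple R * R -> \bar R) :
      measurable_fun setT k -> (forall z, 0 <= k z) ->
      measurable_fun setT (fun t => \int[mu]_y k (t, y)).
    by move=> mk k0; exact: (measurable_fun_fubini_tonelli_F (m2 := mu)).
  rewrite integral_lebesgue_tuple0; last 2 first.
  - apply: (mF (h \o @rcons_pair 0)) => [|z]; last exact: h0.
    by apply: measurableT_comp => //; exact: measurable_rcons_pair.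
  - by move=> t; apply: integral_ge0 => y _; exact: h0.
  apply: eq_integral => x _; rewrite integral_lebesgue_tuple0//.
    by congr h; exact: val_inj.
  apply: measurableT_comp => //.
  apply: measurableT_comp (@measurable_cons_pair R 0) _.
  exact: pair1_measurable.
have mc : measurable_fun setT (h \o @cons_pair R n.+1).
  by apply: measurableT_comp => //; exact: measurable_cons_pair.
have mr : measurable_fun setT (h \o @rcons_pair n.+1).
  by apply: measurableT_comp => //; exact: measurable_rcons_pair.
rewrite integral_lebesgue_tuple_cons//.
rewrite [RHS]integral_lebesgue_tuple_cons//; last 2 first.
- apply: (measurable_fun_fubini_tonelli_F (m2 := mu) (h \o @rcons_pair n.+1)).
    exact: mr.
  by move=> z; exact: h0.
- by move=> t; apply: integral_ge0 => y _; exact: h0.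
apply: eq_integral => x _; rewrite IHn//.
  apply: eq_integral => t _; apply: eq_integral => y _; congr h; exact: val_inj.
by apply: (measurableT_comp mc); exact: pair1_measurable.
Qed.

Lemma lebR_shift (c : R) (A : set R) : measurable A ->
  pushforward mu (fun y : R => y + c)%R A = mu A.
Proof.
move=> mA.
pose f := (fun y : measurableTypeR R => (y + c)%R : measurableTypeR R).
have mf : measurable_fun setT f by exact: measurable_funD.
have [nu nuE] := pushforward_measure_of (@lebesgue_measure R) mf.
rewrite -[LHS]/(pushforward (@lebesgue_measure R) f A) -nuE.
apply/esym/lebesgue_measure_unique => //= _ [[a b]] _ <-.
rewrite nuE /pushforward.
rewrite (_ : _ @^-1` _ = `](a - c)%R, (b - c)%R]%classic); last first.
  by apply/seteqP; split => y; rewrite /= !in_itv/= ltrBlDr lerBrDr.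
have /= -> := lebesgue_measure_itv `](a - c)%R, (b - c)%R].
rewrite lebesgue_measure_itv/= !lte_fin ltrD2; case: ifP => // _.
by rewrite -!EFinB; congr EFin; ring.
Qed.

Lemma lebR_scale (s : R) (s0 : (0 < s)%R) (A : set R) : measurable A ->
  s%:E * pushforward mu (fun y : R => s * y)%R A = mu A.
Proof.
move=> mA.
pose f := (fun y : measurableTypeR R => (s * y)%R : measurableTypeR R).
have mf : measurable_fun setT f by exact: measurable_funM.
pose ns := NngNum (ltW s0).
have [nu nuE] := pushforward_measure_of (@lebesgue_measure R) mf.
rewrite -[pushforward _ _ _]/(pushforward (@lebesgue_measure R) f A) -nuE.
rewrite -[LHS]/(mscale ns nu A).
apply/esym/lebesgue_measure_unique => //= _ [[a b]] _ <-.
rewrite /mscale/= nuE /pushforward.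
rewrite (_ : _ @^-1` _ = `](a / s)%R, (b / s)%R]%classic); last first.
  apply/seteqP; split => y; rewrite /= !in_itv/= ltr_pdivrMr// ler_pdivlMr//.
    by rewrite mulrC.
  by rewrite mulrC.
have /= -> := lebesgue_measure_itv `](a / s)%R, (b / s)%R].
rewrite lebesgue_measure_itv/= !lte_fin ltr_pM2r ?invr_gt0//.
case: ifPn => _; last by rewrite mule0.
by rewrite -EFinD -EFinM -mulrBl mulrC mulfVK// gt_eqF.
Qed.

Lemma ge0_integral_shift (c : R) (h : R -> \bar R) : measurable_fun setT h ->
  (forall y, 0 <= h y) -> \int[mu]_y h y = \int[mu]_y h (y + c)%R.
Proof.
move=> mh h0.
have mc : measurable_fun setT (fun y : R => y + c)%R by exact: measurable_funD.
have [nu nuE] := pushforward_measure_of mu mc.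
transitivity (\int[nu]_y h y).
  by apply: eq_measure_integral => A mA _; rewrite nuE; apply/esym/lebR_shift.
by rewrite nuE ge0_integral_pushforward.
Qed.

Lemma ge0_integral_scale (s : R) (h : R -> \bar R) : (0 < s)%R ->
  measurable_fun setT h -> (forall y, 0 <= h y) ->
  \int[mu]_y h y = s%:E * \int[mu]_y h (s * y)%R.
Proof.
move=> s0 mh h0.
have ms : measurable_fun setT (fun y : R => s * y)%R by exact: measurable_funM.
have [nu nuE] := pushforward_measure_of mu ms.
transitivity (\int[mscale (NngNum (ltW s0)) nu]_y h y).
  apply: eq_measure_integral => A mA _.
  by rewrite -[RHS]/(s%:E * nu A) nuE; apply/esym/lebR_scale.
rewrite ge0_integral_mscale//; congr (_ * _).
by rewrite nuE ge0_integral_pushforward.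
Qed.

End lebesgue_tuple_integral.

(** * Polar coordinates adapted to the simplex *)

Section polar.
Local Open Scope ereal_scope.
Context {R : realType}.
Local Notation mu := (@lebR R).
Local Notation leb := (lebesgue_tuple R).

Definition scale_tuple n (s : R) (t : n.-tuple R) : n.-tuple R :=
  [tuple (s * tnth t i)%R | i < n].

Lemma measurable_scale_tuple n :
  measurable_fun setT (fun z : R * n.-tuple R => scale_tuple z.1 z.2).
Proof.
apply/measurable_fun_tnthP => i.
rewrite (_ : _ \o _ = fun z => (z.1 * tnth z.2 i)%R); last first.
  by apply/funext => z /=; rewrite tnth_mktuple.
apply: measurable_funM => //.
exact: (measurableT_comp (measurable_tnth i) measurable_snd).
Qed.

Lemma measurable_scale_tuple1 n (s : R) :
  measurable_fun setT (@scale_tuple n s).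
Proof.
exact: (measurableT_comp (@measurable_scale_tuple n) (pair1_measurable s)).
Qed.

Lemma scale_cons_pair n (s : R) (z : R * n.-tuple R) :
  scale_tuple s (cons_pair z) = cons_pair (s * z.1, scale_tuple s z.2)%R.
Proof.
apply/eq_from_tnth => i; rewrite tnth_mktuple.
by case: (unliftP ord0 i) => [j|] ->; rewrite ?tnth0// !tnthS tnth_mktuple.
Qed.

Lemma integral_lebesgue_tuple_scale n (s : R) (h : n.-tuple R -> \bar R) :
  (0 < s)%R -> measurable_fun setT h -> (forall t, 0 <= h t) ->
  \int[leb n]_t h t = (s ^+ n)%:E * \int[leb n]_t h (scale_tuple s t).
Proof.
move=> s0; elim: n h => [|n IHn] h mh h0.
  rewrite !integral_lebesgue_tuple0// ?mul1e; last first.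
    by apply: measurableT_comp => //; exact: measurable_scale_tuple1.
  by congr h; apply/eq_from_tnth => -[].
have mhs : measurable_fun setT (h \o @scale_tuple n.+1 s).
  by apply: measurableT_comp => //; exact: measurable_scale_tuple1.
have mhc : measurable_fun setT (h \o @cons_pair R n).
  by apply: measurableT_comp => //; exact: measurable_cons_pair.
have mhcs : measurable_fun setT
    (fun z : R * n.-tuple R => h (cons_pair (z.1, scale_tuple s z.2))).
  apply: (measurableT_comp mhc); apply: measurable_fun_pair => //.
  apply: measurableT_comp => //; exact: measurable_scale_tuple1.
have mG : measurable_fun setT
    (fun x => \int[leb n]_t h (cons_pair (x, scale_tuple s t))).
  by apply: (measurable_fun_fubini_tonelli_F (m2 := leb n)
    (fun z : R * n.-tuple R => h (cons_pair (z.1, scale_tuple s z.2)))).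
rewrite !integral_lebesgue_tuple_cons//.
under eq_integral => x _.
  rewrite IHn//; last first.
    by apply: (measurableT_comp mhc); exact: pair1_measurable.
  over.
rewrite ge0_integralZl//; last 2 first.
- by move=> x _; apply: integral_ge0 => t _; exact: h0.
- by rewrite lee_fin exprn_ge0// ltW.
rewrite [X in _ * X = _](ge0_integral_scale s0)//; last first.
  by move=> x; apply: integral_ge0 => t _; exact: h0.
rewrite muleA -EFinM -exprSr; congr (_ * _).
apply: eq_integral => x _; apply: eq_integral => t _.
by rewrite scale_cons_pair.
Qed.

Lemma measurable_sum_tuple n :
  measurable_fun setT (fun t : n.-tuple R => \sum_(y <- t) y)%R.
Proof.
under eq_fun do rewrite big_tuple.
by apply: measurable_sum => i; exact: measurable_tnth.
Qed.

Lemma scale_simplex_chart m (s : R) (x : m.-tuple R) :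
  scale_tuple s (@simplex_chart R m.+1 x) =
  rcons_pair (scale_tuple s x, s - \sum_(y <- scale_tuple s x) y)%R.
Proof.
apply/eq_from_tnth => i; rewrite !tnth_mktuple.
rewrite (tnth_nth 0%R) /= nth_rcons size_map size_enum_ord.
have [im|im] := ltnP i m.
  rewrite (_ : nth 0%R _ i = tnth (scale_tuple s x) (Ordinal im)); last first.
    by rewrite (tnth_nth 0%R).
  by rewrite tnth_mktuple (tnth_nth (1 - \sum_(y <- x) y)%R).
rewrite eqn_leq im -ltnS ltn_ord/= nth_default ?size_tuple//.
rewrite [in RHS](big_tuple _ _ (scale_tuple s x)) big_tuple.
rewrite mulrBr mulr1 mulr_sumr.
by under [in RHS]eq_bigr do rewrite tnth_mktuple.
Qed.

Lemma sum_rcons_pair n (z : n.-tuple R * R) :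
  (\sum_(y <- rcons_pair z) y = (\sum_(y <- z.1) y) + z.2)%R.
Proof. by rewrite big_rcons/= addrC. Qed.

(** The ray coordinate [s] is the sum of the entries of [t].  For fixed first
    [m] coordinates, replacing the last one by the sum is a shift; for fixed
    sum, dividing the first [m] by it is a scaling with Jacobian [s ^+ m].  As
    the chart takes all values with total 1, points with negative coordinates
    are parametrized as well. *)
Lemma integral_lebesgue_tuple_polar m (h : m.+1.-tuple R -> \bar R) :
  measurable_fun setT h -> (forall t, 0 <= h t) ->
  \int[leb m.+1]_(t in [set t : m.+1.-tuple R | 0 < \sum_(y <- t) y]%R) h t =
  \int[mu]_(s in `]0%R, +oo[) ((s ^+ m)%:E *
    \int[leb m]_x h (scale_tuple s (@simplex_chart R m.+1 x))).
Proof.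
move=> mh h0; rewrite integral_mkcond.
set D := [set t | _]%R; pose H := h \_ D.
have mD : measurable D.
  rewrite -[D]setTI; apply: measurable_fun_ltr => //.
  exact: measurable_sum_tuple.
have mH : measurable_fun setT H.
  by apply/(measurable_restrictT _ mD); exact: measurable_funTS.
have H0 t : 0 <= H t by rewrite /H patchE; case: ifP.
pose psi (z : m.-tuple R * R) := rcons_pair (z.1, z.2 - \sum_(y <- z.1) y)%R.
have mpsi : measurable_fun setT psi.
  apply: measurableT_comp; first exact: measurable_rcons_pair.
  apply: measurable_fun_pair => //; apply: measurable_funB => //.
  exact: (measurableT_comp (@measurable_sum_tuple m) measurable_fst).
have psiS z : (\sum_(y <- psi z) y = z.2)%R.
  by rewrite sum_rcons_pair/= addrC subrK.
have Dpsi z : D (psi z) <-> (0 < z.2)%R by rewrite -[in X in _ <-> X]psiS.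
rewrite integral_lebesgue_tuple_rcons//.
transitivity (\int[leb m]_t \int[mu]_y (H \o psi) (t, y)).
  apply: eq_integral => t _.
  (* The last coordinate becomes the sum of all of them. *)
  rewrite (@ge0_integral_shift R (- \sum_(y <- t) y)%R)//.
  apply: measurableT_comp => //.
  apply: (measurableT_comp (@measurable_rcons_pair R m)).
  exact: pair1_measurable.
rewrite fubini_tonelli//; last 2 first.
- by apply: measurableT_comp.
- by move=> z; exact: H0.
rewrite [RHS]integral_mkcond; apply: eq_integral => s _.
rewrite patchE; case: ifPn; rewrite (inE, notin_setE)/= in_itv/= andbT => s0.
  transitivity (\int[leb m]_x h (psi (x, s))).
    apply: eq_integral => x _ /=; rewrite /H patchE ifT//.
    by apply/mem_set/(iffRL (Dpsi (x, s))).
  rewrite (integral_lebesgue_tuple_scale s0)//.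
    congr (_ * _); apply: eq_integral => x _; congr h.
    by rewrite scale_simplex_chart.
  apply: measurableT_comp => //; apply: (measurableT_comp mpsi).
  exact: pair2_measurable.
rewrite integral0_eq// => x _ /=; rewrite /H patchE ifF//.
by apply/negbTE; rewrite notin_setE => /(iffLR (Dpsi (x, s))) /=; apply: s0.
Qed.

End polar.

(** * Products of densities *)

Section tuple_product_density.
Local Open Scope ereal_scope.
Context {R : realType}.
Local Notation mu := (@lebR R).
Local Notation leb := (lebesgue_tuple R).

Lemma measurable_prod_tuple d (T : measurableType d) n (g : 'I_n -> T -> R) :
  (forall j, measurable_fun setT (g j)) ->
  measurable_fun setT (fun t => \prod_(j < n) g j t)%R.
Proof. by move=> mg; apply: measurable_prod => j _. Qed.

(** Tonelli's theorem is applied to Lebesgue measure alone: the induction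
    hypothesis replaces the product of the tail measures, evaluated on a
    section, by an integral against Lebesgue measure on tuples.  In this way
    factors of infinite mass are allowed. *)
Lemma tuple_product_density n (g : 'I_n -> R -> R) (A : set (n.-tuple R)) :
  (forall j, measurable_fun setT (g j)) -> (forall j x, 0 <= g j x)%R ->
  measurable A ->
  tuple_product (T := R)
    (fun j (B : set R) => \int[lebesgue_measure]_(x in B) (g j x)%:E) A =
  \int[leb n]_(t in A) (\prod_(j < n) g j (tnth t j))%:E.
Proof.
elim: n g A => [|n IHn] g A mg g0 mA.
  under eq_integral do rewrite big_ord0.
  by rewrite integral_cst// mul1e.
pose m0 (B : set R) := \int[lebesgue_measure]_(x in B) (g ord0 x)%:E.
have mg0 : measurable_fun setT (EFin \o g ord0) by exact/measurable_EFinP.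
have [nu nuE] : {nu : {measure set R -> \bar R} |
    (nu : set R -> \bar R) = m0}.
  apply: measure_of.
  - by rewrite /m0 integral_set0.
  - by move=> B; apply: integral_ge0 => x _; rewrite lee_fin.
  - have g00 x : 0 <= (EFin \o g ord0) x by rewrite lee_fin.
    have nu_add := semi_sigma_additive_nng_induced
      (mu := @lebesgue_measure R) mg0 g00.
    exact: nu_add.
pose C := @cons_pair R n @^-1` A.
have mC : measurable C.
  by apply: measurable_preimage => //; exact: measurable_cons_pair.
pose G (t : n.-tuple R) := (\prod_(j < n) g (lift ord0 j) (tnth t j))%R.
have mG : measurable_fun setT G.
  apply: measurable_prod_tuple => j; apply: measurableT_comp => //.
  exact: measurable_tnth.
have G0 t : (0 <= G t)%R by exact: prodr_ge0.
pose F := (fun z : R * n.-tuple R => (G z.2)%:E) \_ C.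
have mF : measurable_fun setT F.
  apply/(measurable_restrictT _ mC); apply: measurable_funTS.
  by apply/measurable_EFinP; exact: (measurableT_comp mG measurable_snd).
have F0 z : 0 <= F z by rewrite /F patchE; case: ifP => // _; rewrite lee_fin.
have IH x : tuple_product (T := R) (fun j (B : set R) =>
    \int[lebesgue_measure]_(x in B) (g (lift ord0 j) x)%:E) (xsection C x) =
    \int[leb n]_t F (x, t).
  rewrite IHn//; last exact: measurable_xsection.
  rewrite integral_mkcond; apply: eq_integral => t _.
  by rewrite /F !patchE; congr (if _ then _ else _); rewrite mem_xsection.
transitivity (\int[nu]_x \int[leb n]_t F (x, t)).
  rewrite nuE /= /pushforward /product_measure1.
  congr (integral _ _ _); apply/funext => x; exact: IH.
rewrite (ge0_integral_density (m := mu) (g := EFin \o g ord0))//; last 4 first.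
- by move=> x; rewrite lee_fin.
- move=> B mB; rewrite nuE integral_lebR//; first exact: measurable_funTS.
  by move=> x _; rewrite lee_fin.
- exact: (measurable_fun_fubini_tonelli_F (m2 := leb n)).
- by move=> x; exact: integral_ge0.
rewrite [RHS]integral_mkcond integral_lebesgue_tuple_cons; last 2 first.
- apply/(measurable_restrictT _ mA); apply: measurable_funTS.
  apply/measurable_EFinP; apply: measurable_prod_tuple => j.
  by apply: measurableT_comp => //; exact: measurable_tnth.
- by move=> t; rewrite patchE; case: ifP => // _; rewrite lee_fin prodr_ge0.
apply: eq_integral => x _; rewrite /= muleC -ge0_integralZl//; last 2 first.
- exact: (measurableT_comp mF (pair1_measurable x)).
- by rewrite lee_fin.
apply: eq_integral => t _; rewrite /F !patchE /=.
rewrite (_ : ((x, t) \in C) = (cons_pair (x, t) \in A)); last first.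
  by apply/idP/idP; rewrite !inE.
case: ifP => _; last by rewrite mule0.
rewrite big_ord_recl/= tnth0 EFinM; congr (_ * _%:E).
by apply: eq_bigr => j _; rewrite tnthS.
Qed.

End tuple_product_density.

(** * Measurability and algebra of the maps involved *)

Section measurability.
Context {R : realType}.

(** The inverse is [x * (x ^+ 2) `^ (-1)], a product of measurable functions;
    this also holds at 0. *)
Lemma measurable_inv : measurable_fun setT (@GRing.inv R).
Proof.
rewrite (_ : GRing.inv = (fun x : R => x * (x ^+ 2) `^ (-1)) :> (R -> R)).
  apply: measurable_funM => //.
  have powX := measurableT_comp (@measurable_powR R (-1))
    (@exprn_measurable R setT 2).
  exact: powX.
apply/funext => x; rewrite powR_inv1 ?sqr_ge0//.
have [->|x0] := eqVneq x 0; first by rewrite invr0 mul0r.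
by rewrite expr2 invfM mulrA divff// mul1r.
Qed.

Lemma measurable_fun_div d (T : measurableType d) (f g : T -> R) :
  measurable_fun setT f -> measurable_fun setT g ->
  measurable_fun setT (fun x => f x / g x).
Proof.
move=> mf mg; apply: measurable_funM => //.
exact: (measurableT_comp measurable_inv mg).
Qed.

Lemma measurable_normalize n : measurable_fun setT (@normalize R n).
Proof.
apply/measurable_fun_tnthP => i.
rewrite (_ : _ \o _ = fun t => tnth t i / \sum_(j < n) tnth t j); last first.
  by apply/funext => t; rewrite /= tnth_mktuple.
apply: measurable_fun_div; first exact: measurable_tnth.
by apply: measurable_sum => j; exact: measurable_tnth.
Qed.

Lemma measurable_simplex n : measurable (@simplex R n).
Proof.
rewrite (_ : @simplex R n =
    (\bigcap_(j in [set: 'I_n]) [set t : n.-tuple R | 0 <= tnth t j]) `&`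
    [set t : n.-tuple R | \sum_(j < n) tnth t j = 1]); last first.
  apply/seteqP; split => [t [t0 t1]|t [t0 t1]]; split => // j; last exact: t0.
  by move=> _; exact: t0.
apply: measurableI.
  apply: fin_bigcap_measurable => // j _.
  rewrite -[X in measurable X]setTI; apply: measurable_fun_ler => //.
  exact: measurable_tnth.
rewrite (_ : [set _ | _] =
    (fun t : n.-tuple R => \sum_(j < n) tnth t j) @^-1` [set 1]).
  apply: measurable_preimage => //.
  by apply: measurable_sum => j; exact: measurable_tnth.
by apply/seteqP; split.
Qed.

Lemma simplex_chart_rcons m (x : m.-tuple R) :
  @simplex_chart R m.+1 x = rcons_pair (x, 1 - \sum_(y <- x) y).
Proof.
rewrite (_ : @simplex_chart R m.+1 x = scale_tuple 1 (@simplex_chart R m.+1 x)).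
  rewrite scale_simplex_chart; have -> // : scale_tuple 1 x = x.
  by apply/eq_from_tnth => i; rewrite tnth_mktuple mul1r.
by apply/eq_from_tnth => i; rewrite [RHS]tnth_mktuple mul1r.
Qed.

Lemma sum_simplex_chart m (x : m.-tuple R) :
  \sum_(i < m.+1) tnth (@simplex_chart R m.+1 x) i = 1.
Proof.
transitivity (\sum_(y <- @simplex_chart R m.+1 x) y).
  by rewrite big_tuple.
by rewrite simplex_chart_rcons sum_rcons_pair/= addrC subrK.
Qed.

Lemma measurable_simplex_chart m : measurable_fun setT (@simplex_chart R m.+1).
Proof.
rewrite (_ : @simplex_chart R m.+1 =
    (@rcons_pair R m) \o
      (fun x : m.-tuple R => (x, 1 - \sum_(y <- x) y))); last first.
  by apply/funext => x; rewrite simplex_chart_rcons.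
apply: measurableT_comp; first exact: measurable_rcons_pair.
apply: measurable_fun_pair => //; apply: measurable_funB => //.
exact: measurable_sum_tuple.
Qed.

Lemma normalize_scale n (s : R) (t : n.-tuple R) : s != 0 ->
  \sum_(i < n) tnth t i = 1 -> normalize (scale_tuple s t) = t.
Proof.
move=> s0 t1; apply/eq_from_tnth => i; rewrite tnth_mktuple.
rewrite (_ : \sum_(j < n) tnth (scale_tuple s t) j = s); last first.
  by under eq_bigr do rewrite tnth_mktuple; rewrite -mulr_sumr t1 mulr1.
by rewrite tnth_mktuple mulrAC divff// mul1r.
Qed.

(** The giG weight, extended by 0 to the whole line and taken jointly in the
    parameter [z.1] and the point [z.2], so that it can be integrated in either
    of them. *)
Definition giG_kernel (lambda rho : R) (z : R * R) : R :=
  if 0 < z.2 then giG_weight lambda rho (2 * `|z.1|) z.2 else 0.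

Lemma giG_kernel_ge0 lambda rho z : 0 <= giG_kernel lambda rho z.
Proof.
by rewrite /giG_kernel; case: ifP => // _; rewrite mulr_ge0 ?powR_ge0 ?expR_ge0.
Qed.

Lemma measurable_giG_kernel lambda rho :
  measurable_fun setT (giG_kernel lambda rho).
Proof.
apply: measurable_fun_ifT => //; first exact: measurable_fun_ltr.
apply: measurable_funM.
  exact: (measurableT_comp (measurable_powR _) measurable_snd).
apply: measurableT_comp => //; apply: measurable_funN.
apply: measurable_funM => //.
apply: measurable_funD; first exact: measurable_funM.
apply: measurable_fun_div => //; apply: measurable_funM => //.
exact: measurableT_comp.
Qed.

Local Notation leb := (lebesgue_tuple R).

Lemma integral_prod_tuple n (g : 'I_n -> R -> R) :
  (forall j, measurable_fun setT (g j)) -> (forall j x, 0 <= g j x) ->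
  (\int[leb n]_t (\prod_(j < n) g j (tnth t j))%:E =
   \prod_(j < n) \int[lebR]_x (g j x)%:E)%E.
Proof.
elim: n g => [|n IHn] g mg g0.
  rewrite integral_lebesgue_tuple0 ?big_ord0//.
  - under eq_fun do rewrite big_ord0; exact: measurable_cst.
  - by move=> t; rewrite lee_fin prodr_ge0.
rewrite integral_lebesgue_tuple_cons; last 2 first.
- apply/measurable_EFinP/measurable_prod_tuple => j.
  by apply: measurableT_comp => //; exact: measurable_tnth.
- by move=> t; rewrite lee_fin prodr_ge0.
rewrite big_ord_recl -IHn//.
rewrite -ge0_integralZr//; last 3 first.
- exact/measurable_EFinP.
- by move=> x _; rewrite lee_fin.
- by apply: integral_ge0 => t _; rewrite lee_fin prodr_ge0.
apply: eq_integral => x _; rewrite -ge0_integralZl//; last 3 first.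
- apply/measurable_EFinP/measurable_prod_tuple => j.
  by apply: measurableT_comp => //; exact: measurable_tnth.
- by move=> t _; rewrite lee_fin prodr_ge0.
- by rewrite lee_fin.
apply: eq_integral => t _; rewrite big_ord_recl/= tnth0 EFinM.
congr (_ * _%:E)%E.
by apply: eq_bigr => j _; rewrite tnthS.
Qed.

End measurability.

(** * The law of the prior pair (phi, tau) *)

Lemma ge0_integral_pushforward_density d1 d2 (T1 : measurableType d1)
    (T2 : measurableType d2) (R : realType) (m : {measure set T1 -> \bar R})
    (nu : {measure set T2 -> \bar R}) (c : T1 -> T2) (g : T1 -> \bar R)
    (f : T2 -> \bar R) :
  measurable_fun setT c -> measurable_fun setT g -> (forall x, 0 <= g x)%E ->
  (forall A, measurable A -> nu A = \int[m]_(x in c @^-1` A) g x)%E ->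
  measurable_fun setT f -> (forall y, 0 <= f y)%E ->
  (\int[nu]_y f y = \int[m]_x (f (c x) * g x))%E.
Proof.
move=> mc mg g0 nuE mf f0.
have [M ME] := density_measure_of m mg g0.
have [N NE] := pushforward_measure_of M mc.
transitivity (\int[N]_y f y)%E.
  by apply: eq_measure_integral => A mA _; rewrite NE /pushforward ME nuE.
rewrite NE ge0_integral_pushforward// preimage_setT.
rewrite (ge0_integral_density (m := m) (g := g))//.
- by move=> A _; rewrite ME.
- exact: measurableT_comp.
- by move=> x; exact: f0.
Qed.

Lemma integral_independent_pair d d1 d2 (Omega : measurableType d)
    (T1 : measurableType d1) (T2 : measurableType d2) (R : realType)
    (P : probability Omega R) (X : {RV P >-> T1}) (Y : {RV P >-> T2})
    (f : T1 * T2 -> \bar R) :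
  independent_pair P X Y -> measurable_fun setT f -> (forall z, 0 <= f z)%E ->
  (\int[P]_w f (X w, Y w) =
   \int[distribution P Y]_y \int[distribution P X]_x f (x, y))%E.
Proof.
move=> XY mf f0.
have mXY : measurable_fun setT (fun w => (X w, Y w)).
  exact: measurable_fun_pair.
have [N NE] := pushforward_measure_of P mXY.
rewrite -fubini_tonelli2//.
transitivity (\int[N]_z f z)%E.
  by rewrite NE ge0_integral_pushforward.
apply/esym/eq_measure_integral => A mA _.
apply: product_measure_unique => // B C mB mC.
by rewrite NE; exact: XY.
Qed.

Section hierarchy_prior.
Local Open Scope ereal_scope.
Context {R : realType} (m : nat) (a : R).
Context d (Omega : measurableType d) (P : probability Omega R).
Variables (phi : {RV P >-> m.+1.-tuple R}) (tau : {RV P >-> R}).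
Hypothesis hphi : has_law P phi (@symmetric_Dirichlet R m.+1 a).
Hypothesis htau : has_law P tau (gamma_law (m.+1%:R * a) 2^-1).
Hypothesis hind : independent_pair P phi tau.
Local Notation leb := (lebesgue_tuple R).
Local Notation chart := (@simplex_chart R m.+1).

Definition Dirichlet_const : R :=
  (gamma_function (m.+1%:R * a) / gamma_function a ^+ m.+1)%R.

Definition gamma_const : R :=
  ((2^-1) `^ (m.+1%:R * a) / gamma_function (m.+1%:R * a))%R.

Lemma gamma_function_ge0 (b : R) : (0 <= gamma_function b)%R.
Proof.
apply/fine_ge0/integral_ge0 => x _.
by rewrite lee_fin mulr_ge0 ?powR_ge0 ?expR_ge0.
Qed.

Lemma Dirichlet_const_ge0 : (0 <= Dirichlet_const)%R.
Proof. by rewrite divr_ge0 ?exprn_ge0 ?gamma_function_ge0. Qed.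

Lemma gamma_const_ge0 : (0 <= gamma_const)%R.
Proof. by rewrite divr_ge0 ?powR_ge0 ?gamma_function_ge0. Qed.

Definition Dirichlet_density : m.-tuple R -> \bar R :=
  (fun x => (Dirichlet_const *
     \prod_(j < m.+1) tnth (chart x) j `^ (a - 1))%:E)
    \_ (chart @^-1` @simplex R m.+1).

Definition gamma_density : R -> \bar R :=
  (fun s : R => (gamma_const * s `^ (m.+1%:R * a - 1) * expR (- (2^-1 * s)))%:E)
    \_ `]0%R, +oo[.

Lemma Dirichlet_density_ge0 x : 0 <= Dirichlet_density x.
Proof.
rewrite /Dirichlet_density patchE; case: ifP => // _.
rewrite lee_fin mulr_ge0 ?Dirichlet_const_ge0// prodr_ge0// => j _.
exact: powR_ge0.
Qed.

Lemma gamma_density_ge0 x : 0 <= gamma_density x.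
Proof.
rewrite /gamma_density patchE; case: ifP => // _.
by rewrite lee_fin mulr_ge0 ?expR_ge0// mulr_ge0 ?powR_ge0 ?gamma_const_ge0.
Qed.

Lemma measurable_Dirichlet_density : measurable_fun setT Dirichlet_density.
Proof.
have mS := measurable_preimage (@measurable_simplex_chart R m)
  (@measurable_simplex R m.+1).
apply/(measurable_restrictT _ mS).
apply: measurable_funTS; apply/measurable_EFinP; apply: measurable_funM => //.
apply: measurable_prod_tuple => j.
have mc := measurableT_comp (@measurable_tnth _ R m.+1 j)
  (@measurable_simplex_chart R m).
exact: (measurableT_comp (@measurable_powR R (a - 1)) mc).
Qed.

Lemma measurable_gamma_density : measurable_fun setT gamma_density.
Proof.
have mI : measurable (`]0%R, +oo[%classic : set R) by exact: measurable_itv.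
apply/(measurable_restrictT _ mI).
apply: measurable_funTS; apply/measurable_EFinP; apply: measurable_funM.
  by apply: measurable_funM => //; exact: measurable_powR.
apply: measurableT_comp => //; apply: measurable_funN; exact: measurable_funM.
Qed.

Lemma integral_phi (f : m.+1.-tuple R -> \bar R) : measurable_fun setT f ->
  (forall t, 0 <= f t) ->
  \int[distribution P phi]_t f t =
  \int[leb m]_x (f (chart x) * Dirichlet_density x).
Proof.
move=> mf f0.
apply: (ge0_integral_pushforward_density (m := leb m)) => //.
- exact: measurable_simplex_chart.
- exact: measurable_Dirichlet_density.
- exact: Dirichlet_density_ge0.
- move=> A mA; rewrite [LHS]hphi//.
  rewrite -[LHS]/(\int[leb m]_(x in chart @^-1` A `&` chart @^-1` @simplex R m.+1)
    (Dirichlet_const * \prod_(j < m.+1) tnth (chart x) j `^ (a - 1))%:E).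
  by rewrite integral_mkcondr.
Qed.

Lemma integral_tau (f : R -> \bar R) : measurable_fun setT f ->
  (forall t, 0 <= f t) ->
  \int[distribution P tau]_t f t = \int[lebR]_s (f s * gamma_density s).
Proof.
move=> mf f0; apply: ge0_integral_density => //.
- exact: measurable_gamma_density.
- exact: gamma_density_ge0.
- move=> A mA; rewrite [LHS]htau// /gamma_law integral_mkcondr.
  rewrite integral_lebR//.
  + by apply: measurable_funTS; exact: measurable_gamma_density.
  + by move=> x _; exact: gamma_density_ge0.
Qed.

(** The prior expectation as an iterated Lebesgue integral, the radial variable
    outside: this is the shape of the right-hand side of the polar formula. *)
Lemma integral_prior (f : m.+1.-tuple R * R -> \bar R) :
  measurable_fun setT f -> (forall z, 0 <= f z) ->
  \int[P]_w f (phi w, tau w) =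
  \int[lebR]_s ((\int[leb m]_x (f (chart x, s) * Dirichlet_density x)) *
     gamma_density s).
Proof.
move=> mf f0; rewrite integral_independent_pair// integral_tau; last 2 first.
- exact: (measurable_fun_fubini_tonelli_G (m1 := distribution P phi)).
- by move=> s; apply: integral_ge0.
apply: eq_integral => s _; rewrite integral_phi//.
exact: (measurableT_comp mf (pair2_measurable s)).
Qed.

End hierarchy_prior.

(** * The density in polar coordinates *)

Section pointwise.
Context {R : realType}.

Definition double_exponential_density (s x : R) : R :=
  (2 * s)^-1 * expR (- `|x| / s).

Lemma double_exponential_density_ge0 s x : 0 <= s ->
  0 <= double_exponential_density s x.
Proof. by move=> s0; rewrite mulr_ge0 ?expR_ge0// invr_ge0 mulr_ge0. Qed.

(** The factors of the prior and of the likelihood that involve coordinate [j]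
    combine to a giG weight at [s * f].  At [f = 0] both sides vanish, the left
    one since the scale of the double exponential law is then 0 and
    [0^-1 = 0]. *)
Lemma coordinate_identity (a f s t : R) : 0 <= f -> 0 < s ->
  f `^ (a - 1) * double_exponential_density (f * s) t *
    expR (- (2^-1 * (s * f))) =
  2^-1 * s `^ (1 - a) * giG_kernel (a - 1) 1 (t, s * f).
Proof.
rewrite le_eqVlt => /predU1P[<- s0|f0 s0].
  rewrite /giG_kernel /double_exponential_density/= mul0r !mulr0 ltxx invr0.
  by rewrite mul0r !mulr0 mul0r.
rewrite /giG_kernel /double_exponential_density/= mulr_gt0// /giG_weight.
have fN0 : f != 0 by rewrite gt_eqF.
have sN0 : s != 0 by rewrite gt_eqF.
rewrite (powRM _ (ltW s0) (ltW f0)).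
rewrite -[in f `^ (a - 1)](subrK 1 (a - 1)) (@powRD _ f (a - 1 - 1) 1); last first.
  by rewrite fN0 implybT.
rewrite powRr1 ?ltW//.
have -> : s `^ (a - 1 - 1) = s `^ (a - 1) * s^-1.
  by rewrite powRD ?sN0 ?implybT// powR_inv1// ltW.
have ss : s `^ (1 - a) * s `^ (a - 1) = 1.
  rewrite -powRD ?sN0 ?implybT//.
  by rewrite addrC addrA subrK subrr powRr0.
have -> : expR (- (2^-1 * (1 * (s * f) + 2 * `|t| / (s * f)))) =
    expR (- `|t| / (f * s)) * expR (- (2^-1 * (s * f))).
  by rewrite -expRD; congr expR; field; rewrite fN0 sN0.
set E1 := expR _; set E2 := expR _; set p := f `^ _.
set q := s `^ (a - 1) in ss *.
set r := s `^ (1 - a) in ss *.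
transitivity (2^-1 * (r * q) * p * s^-1 * E1 * E2); last by ring.
by rewrite ss; field; rewrite fN0 sN0.
Qed.

(** Since [f] sums to 1, the factor [e^(- s / 2)] of the gamma density splits
    over the coordinates.  The powers of [s] add up to
    [n.+1 * a - 1 + n.+1 * (1 - a) = n], the exponent of the polar Jacobian. *)
Lemma density_identity n (a s : R) (f t : n.+1.-tuple R) :
  (forall j, 0 <= tnth f j) -> \sum_(j < n.+1) tnth f j = 1 -> 0 < s ->
  s `^ (n.+1%:R * a - 1) * expR (- (2^-1 * s)) *
    \prod_(j < n.+1) tnth f j `^ (a - 1) *
    \prod_(j < n.+1) double_exponential_density (tnth f j * s) (tnth t j) =
  2^-1 ^+ n.+1 * (s ^+ n *
    \prod_(j < n.+1) giG_kernel (a - 1) 1 (tnth t j, s * tnth f j)).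
Proof.
move=> f0 f1 s0.
have -> : expR (- (2^-1 * s)) =
    \prod_(j < n.+1) expR (- (2^-1 * (s * tnth f j))).
  by rewrite -expR_sum sumrN -!mulr_sumr f1 mulr1.
have -> : s ^+ n = s `^ (n.+1%:R * a - 1) * (s `^ (1 - a)) ^+ n.+1.
  rewrite -(powR_mulrn n.+1 (powR_ge0 s (1 - a))) -powRrM -powRD; last first.
    by rewrite (gt_eqF s0) implybT.
  rewrite -powR_mulrn ?ltW//; congr (_ `^ _).
  by rewrite -[in RHS]natr1; ring.
transitivity (s `^ (n.+1%:R * a - 1) * \prod_(j < n.+1)
  (tnth f j `^ (a - 1) * double_exponential_density (tnth f j * s) (tnth t j)
    * expR (- (2^-1 * (s * tnth f j))))).
  by rewrite !big_split/=; ring.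
under eq_bigr do rewrite coordinate_identity//.
rewrite !big_split/= !prodr_const !card_ord; ring.
Qed.

End pointwise.

(** * The joint law of theta and phi *)

Section posterior.
Local Open Scope ereal_scope.
Context {R : realType} (n : nat) (a : R).
Local Notation leb := (lebesgue_tuple R).

Definition giG_prod (z : n.-tuple R * n.-tuple R) : R :=
  (\prod_(j < n) giG_kernel (a - 1) 1 (tnth z.1 j, tnth z.2 j))%R.

Lemma giG_prod_ge0 z : (0 <= giG_prod z)%R.
Proof. by apply: prodr_ge0 => j _; exact: giG_kernel_ge0. Qed.

Lemma measurable_giG_prod : measurable_fun setT giG_prod.
Proof.
apply: measurable_prod_tuple => j.
apply: (measurableT_comp (@measurable_giG_kernel R (a - 1) 1)).
apply: measurable_fun_pair.
  exact: (measurableT_comp (measurable_tnth j) measurable_fst).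
exact: (measurableT_comp (measurable_tnth j) measurable_snd).
Qed.

(** The image under [normalize] of the unnormalized product of giG densities. *)
Definition giG_mass (t : n.-tuple R) (B : set (n.-tuple R)) : \bar R :=
  \int[leb n]_(T in @normalize R n @^-1` B) (giG_prod (t, T))%:E.

Lemma giG_prod_sum_gt0 t T : (0 < n)%N -> giG_prod (t, T) != 0%R ->
  (0 < \sum_(y <- T) y)%R.
Proof.
move=> n0 q0.
have T0 j : (0 < tnth T j)%R.
  rewrite ltNge; apply/negP => Tj; move/negP: q0; apply.
  by rewrite /giG_prod (bigD1 j)//= /giG_kernel/= ltNge Tj mul0r.
rewrite big_tuple (bigD1 (Ordinal n0))//= ltr_wpDr// sumr_ge0// => j _.
exact: ltW.
Qed.

End posterior.

Section joint_law.
Local Open Scope ereal_scope.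
Context {R : realType} (m : nat) (a : R).
Context d (Omega : measurableType d) (P : probability Omega R).
Variables (theta phi : {RV P >-> m.+1.-tuple R}) (tau : {RV P >-> R}).
Hypothesis hphi : has_law P phi (@symmetric_Dirichlet R m.+1 a).
Hypothesis htau : has_law P tau (gamma_law (m.+1%:R * a) 2^-1).
Hypothesis hind : independent_pair P phi tau.
Hypothesis htheta : conditional_law P (fun w => (phi w, tau w)) theta
  (fun u => tuple_product
     (fun j : 'I_m.+1 => double_exponential (tnth u.1 j * u.2))).
Local Notation leb := (lebesgue_tuple R).
Local Notation chart := (@simplex_chart R m.+1).
Let n := m.+1.

Definition posterior_const : R :=
  (Dirichlet_const m a * gamma_const m a * 2^-1 ^+ n)%R.

Lemma posterior_const_ge0 : (0 <= posterior_const)%R.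
Proof.
rewrite /posterior_const mulr_ge0// ?exprn_ge0//.
by rewrite mulr_ge0 ?Dirichlet_const_ge0 ?gamma_const_ge0.
Qed.

Variables (A B : set (n.-tuple R)).
Hypotheses (mA : measurable A) (mB : measurable B).

Let S : set (n.-tuple R * R) := (B `&` @simplex R n) `*` `]0%R, +oo[.

Let mS : measurable S.
Proof.
by apply: measurableX => //; apply: measurableI => //; exact: measurable_simplex.
Qed.

Definition likelihood (z : (n.-tuple R * R) * n.-tuple R) : R :=
  (\prod_(j < n)
    double_exponential_density (tnth z.1.1 j * z.1.2) (tnth z.2 j))%R.

Lemma measurable_likelihood : measurable_fun setT likelihood.
Proof.
apply: measurable_prod_tuple => j.
have m1 : measurable_fun setT
    (fun z : (n.-tuple R * R) * n.-tuple R => tnth z.1.1 j * z.1.2)%R.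
  apply: measurable_funM.
    apply: (measurableT_comp (measurable_tnth j)).
    exact: (measurableT_comp measurable_fst measurable_fst).
  exact: (measurableT_comp measurable_snd measurable_fst).
have m2 : measurable_fun setT
    (fun z : (n.-tuple R * R) * n.-tuple R => tnth z.2 j).
  exact: (measurableT_comp (measurable_tnth j) measurable_snd).
apply: measurable_funM.
  by apply: (measurableT_comp measurable_inv); exact: measurable_funM.
apply: measurableT_comp => //; apply: measurable_fun_div => //.
by apply: measurable_funN; exact: measurableT_comp.
Qed.

Let joint_density := (fun z => (likelihood z)%:E) \_ (S `*` A).

Let measurable_joint_density : measurable_fun setT joint_density.
Proof.
have mSA := measurableX mS mA.
apply/(measurable_restrictT _ mSA); apply: measurable_funTS.
by apply/measurable_EFinP; exact: measurable_likelihood.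
Qed.

Let joint_density_ge0 z : 0 <= joint_density z.
Proof.
rewrite /joint_density patchE; case: ifPn => //; rewrite inE => -[[[_ [z0 _]]] /=].
rewrite in_itv/= andbT => s0 _; rewrite lee_fin prodr_ge0// => j _.
by rewrite double_exponential_density_ge0// mulr_ge0// ltW.
Qed.

(** The pair [(phi, tau)] lies almost surely in the simplex times the positive
    reals; there the scales [phi_j tau] are nonnegative, which makes the double
    exponential weights densities of measures. *)
Let joint_event_supported : P (theta @^-1` A `&` phi @^-1` B) =
  P ((fun w => (phi w, tau w)) @^-1` S `&` theta @^-1` A).
Proof.
have mth : measurable (theta @^-1` A) by exact: measurable_preimage.
have mphi C : measurable C -> measurable (phi @^-1` C).
  by move=> mC; exact: measurable_preimage.
have mtau C : measurable C -> measurable (tau @^-1` C).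
  by move=> mC; exact: measurable_preimage.
pose G := phi @^-1` @simplex R n `&` tau @^-1` `]0%R, +oo[.
have mG : measurable G.
  by apply: measurableI; [exact: mphi (@measurable_simplex R n)|exact: mtau].
have PG : P (~` G) = 0.
  apply/eqP; rewrite -measure_le0 /G setCI.
  have mSc : measurable (~` @simplex R n).
    exact: measurableC (@measurable_simplex R n).
  have mIc : measurable (~` `]0%R, +oo[ : set R) by exact: measurableC.
  rewrite !preimage_setC.
  apply: (le_trans (measureU2 P (mphi _ mSc) (mtau _ mIc))).
  have P1 : P (phi @^-1` ~` @simplex R n) = 0.
    rewrite (hphi mSc) /symmetric_Dirichlet setICl (preimage_set0 chart).
    exact: (integral_set0 (leb m)).
  have P2 : P (tau @^-1` ~` `]0%R, +oo[) = 0.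
    by rewrite (htau mIc) /gamma_law setICl integral_set0.
  by rewrite [X in X + _]P1 [X in _ + X]P2 adde0.
have mE : measurable (theta @^-1` A `&` phi @^-1` B).
  by apply: measurableI => //; exact: mphi.
rewrite [LHS](measureDI _ mE mG).
rewrite [X in X + _](_ : _ = 0) ?add0e; last first.
  apply/eqP; rewrite -measure_le0 -PG le_measure ?inE//.
  - exact: measurableD.
  - exact: measurableC.
apply: congr1; apply/seteqP; split => w /=.
  by move=> [[Aw Bw] [Sw tw]].
by move=> [[[Bw Sw] tw] Aw].
Qed.

(** For a fixed observation [t], integrating [(phi, tau)] out is the polar
    formula read from right to left. *)
Let integral_joint_density t : A t ->
  \int[P]_w joint_density ((phi w, tau w), t) =
  posterior_const%:E * giG_mass a t B.
Proof.
move=> At.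
rewrite (integral_prior hphi htau hind
  (f := fun u => joint_density (u, t)))//; last first.
  exact: (measurableT_comp measurable_joint_density (pair2_measurable t)).
pose q T := (giG_prod a (t, T))%:E.
have mq : measurable_fun setT q.
  apply/measurable_EFinP.
  exact: (measurableT_comp (measurable_giG_prod a) (pair1_measurable t)).
have q0 T : 0 <= q T by rewrite lee_fin giG_prod_ge0.
have mNB : measurable (@normalize R n @^-1` B).
  by apply: measurable_preimage => //; exact: measurable_normalize.
pose h := q \_ (@normalize R n @^-1` B).
have mh : measurable_fun setT h.
  by apply/(measurable_restrictT _ mNB); exact: measurable_funTS.
have h0 T : 0 <= h T by rewrite /h patchE; case: ifP.
have -> : giG_mass a t B =
    \int[leb n]_(T in [set T : n.-tuple R | 0 < \sum_(y <- T) y]%R) h T.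
  rewrite /giG_mass integral_mkcond [RHS]integral_mkcond.
  apply: eq_integral => T _; rewrite [RHS]patchE; case: ifPn => //.
  rewrite notin_setE/= => T0; rewrite patchE; case: ifP => // _.
  congr EFin; apply/eqP; apply: contrapT => qT; apply: T0.
  by apply: (giG_prod_sum_gt0 (a := a) (t := t)) => //; exact/negP.
rewrite integral_lebesgue_tuple_polar//.
have mhs s : measurable_fun setT (fun x => h (scale_tuple s (chart x))).
  apply: (measurableT_comp mh).
  apply: (measurableT_comp (@measurable_scale_tuple1 R n s)).
  exact: measurable_simplex_chart.
have mhz : measurable_fun setT
    (fun z : R * m.-tuple R => h (scale_tuple z.1 (chart z.2))).
  have mp : measurable_fun setT (fun z : R * m.-tuple R => (z.1, chart z.2)).
    apply: measurable_fun_pair => //.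
    exact: (measurableT_comp (@measurable_simplex_chart R m) measurable_snd).
  have mscale := measurableT_comp (@measurable_scale_tuple R n) mp.
  exact: (measurableT_comp mh mscale).
have mint : measurable_fun setT
    (fun s : R => \int[leb m]_x h (scale_tuple s (chart x))).
  exact: (measurable_fun_fubini_tonelli_F (m2 := leb m)
    (fun z : R * m.-tuple R => h (scale_tuple z.1 (chart z.2)))).
have int0 s : 0 <= \int[leb m]_x h (scale_tuple s (chart x)).
  by apply: integral_ge0 => x _; exact: h0.
have mI : measurable (`]0%R, +oo[%classic : set R) by exact: measurable_itv.
rewrite [in RHS]integral_mkcond -ge0_integralZl//; last 3 first.
- apply/(measurable_restrictT _ mI); apply: measurable_funTS.
  apply: emeasurable_funM => //; apply/measurable_EFinP.
  exact: exprn_measurable.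
- move=> s _; rewrite patchE; case: ifPn => //; rewrite inE/= in_itv/= andbT.
  by move=> s0; rewrite mule_ge0// lee_fin exprn_ge0// ltW.
- by rewrite lee_fin posterior_const_ge0.
apply: eq_integral => s _; rewrite /gamma_density !patchE.
case: ifPn => [|_]; last by rewrite !mule0.
rewrite inE/= in_itv/= andbT => s0.
have mjoint_s : measurable_fun setT (fun x => joint_density ((chart x, s), t)).
  apply: (measurableT_comp measurable_joint_density).
  apply: measurable_fun_pair => //.
  by apply: measurable_fun_pair => //; exact: measurable_simplex_chart.
rewrite -ge0_integralZr//; last 3 first.
- by apply: emeasurable_funM => //; exact: measurable_Dirichlet_density.
- by move=> x _; rewrite mule_ge0// Dirichlet_density_ge0.
- by rewrite lee_fin mulr_ge0 ?expR_ge0// mulr_ge0 ?powR_ge0 ?gamma_const_ge0.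
rewrite muleA -EFinM -ge0_integralZl//; last first.
  by rewrite lee_fin mulr_ge0 ?posterior_const_ge0// exprn_ge0// ltW.
apply: eq_integral => x _.
rewrite /Dirichlet_density /h /joint_density !patchE.
(* Off the simplex some coordinate of [chart x] is negative, because they sum
   to 1; then both sides vanish. *)
have [xS|xS] := pselect (simplex (chart x)); last first.
  rewrite [X in _ * X * _ = _]ifF ?mule0 ?mul0e; last first.
    by apply/negbTE; rewrite notin_setE.
  case: ifP => _; rewrite ?mule0// /q.
  suff -> : giG_prod a (t, scale_tuple s (chart x)) = 0%R by rewrite mule0.
  apply/eqP; apply: contrapT => /negP qN0; apply: xS.
  split; last exact: sum_simplex_chart.
  move=> j; rewrite leNgt; apply/negP => xj0; move/negP : qN0; apply.
  rewrite /giG_prod (bigD1 j)//= /giG_kernel/= tnth_mktuple.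
  by rewrite ltNge ltW ?mul0r// pmulr_rlt0.
have sN0 : s != 0%R by rewrite gt_eqF.
rewrite [X in _ * X * _ = _]ifT; last by rewrite inE.
have nE : normalize (scale_tuple s (chart x)) = chart x.
  by apply: normalize_scale => //; exact: sum_simplex_chart.
have [xB|xB] := pselect (B (chart x)); last first.
  rewrite [X in X * _ * _ = _]ifF; last first.
    by apply/negbTE; rewrite notin_setE => -[[[]]].
  rewrite [X in _ = _ * X]ifF ?mule0 ?mul0e//.
  by apply/negbTE; rewrite notin_setE /= nE.
rewrite [X in X * _ * _ = _]ifT; last first.
  by rewrite inE; split => //; split => //=; rewrite in_itv/= s0.
rewrite [X in _ = _ * X]ifT; last by rewrite inE/= nE.
rewrite /q -!EFinM; congr EFin.
have [x0 x1] := xS.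
have := density_identity a t x0 x1 s0.
rewrite -[X in (_ * X)%R = _ -> _]/(likelihood ((chart x, s), t)).
have -> : giG_prod a (t, scale_tuple s (chart x)) =
    (\prod_(j < m.+1) giG_kernel (a - 1) 1 (tnth t j, s * tnth (chart x) j))%R.
  by apply: eq_bigr => j _; rewrite /= tnth_mktuple.
rewrite /posterior_const -/n.
set p1 := (\prod_(j < _) _)%R; set p3 := (\prod_(j < _) _)%R.
set p2 := likelihood _; set c1 := Dirichlet_const _ _.
set c2 := gamma_const _ _; set s1 := (s `^ _)%R; set e1 := expR _ => e.
transitivity (c1 * c2 * (s1 * e1 * p1 * p2))%R; first by ring.
by rewrite e; ring.
Qed.

Lemma joint_law : P (theta @^-1` A `&` phi @^-1` B) =
  \int[leb n]_(t in A) (posterior_const%:E * giG_mass a t B).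
Proof.
rewrite joint_event_supported htheta//.
transitivity (\int[P]_w \int[leb n]_t joint_density ((phi w, tau w), t)).
  rewrite integral_mkcond; apply: eq_integral => w _.
  rewrite patchE; case: ifPn => wS.
    have [[_ [w0 _]] /=] : S (phi w, tau w) by rewrite inE in wS.
    rewrite in_itv/= andbT => s0.
    rewrite [LHS](tuple_product_density
      (g := fun j => double_exponential_density (tnth (phi w) j * tau w)))//.
    - rewrite integral_mkcond; apply: eq_integral => t _.
      rewrite /joint_density !patchE.
      have -> : (((phi w, tau w), t) \in S `*` A) = (t \in A).
        rewrite inE in wS; apply/idP/idP; rewrite !inE; first by case.
        by move=> At; split.
      by [].
    - move=> j; apply: measurable_funM => //; apply: measurableT_comp => //.
      by apply: measurable_fun_div => //; apply: measurable_funN.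
    - by move=> j x; rewrite double_exponential_density_ge0// mulr_ge0// ltW.
  rewrite integral0_eq// => t _; rewrite /joint_density patchE ifF//.
  by apply: contraNF wS; rewrite !inE => -[].
rewrite (fubini_tonelli (m1 := P) (m2 := leb n)
  (fun z : Omega * n.-tuple R =>
    joint_density ((phi z.1, tau z.1), z.2)))//; last first.
  apply: (measurableT_comp measurable_joint_density).
  apply: measurable_fun_pair => //.
  by apply: measurable_fun_pair; exact: measurableT_comp.
rewrite [RHS]integral_mkcond; apply: eq_integral => t _ /=.
rewrite patchE; case: ifPn; rewrite ?inE ?notin_setE => At.
  exact: integral_joint_density.
by rewrite integral0_eq// => w _; rewrite /joint_density patchE ifF//;
  apply/negbTE; rewrite notin_setE => -[].
Qed.

End joint_law.

(** * Uniqueness of conditional laws *)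

Section rational_box.
Context {R : realType} (n : nat).

Definition le_option (o : option rat) (x : R) : bool :=
  if o is Some q then x <= ratr q else true.

Definition rational_box (q : n.-tuple (option rat)) : set (n.-tuple R) :=
  [set t | forall j, le_option (tnth q j) (tnth t j)].

(** An entry [None] of the corner leaves the coordinate unconstrained, so that
    the whole space is a box.  The enumeration makes the family countable. *)
Definition rational_boxes (k : nat) : set (n.-tuple R) :=
  if unpickle k is Some q then rational_box q else setT.

Definition min_option (o1 o2 : option rat) : option rat :=
  match o1, o2 with
  | Some q1, Some q2 => Some (Order.min q1 q2)
  | Some q, None | None, Some q => Some q
  | None, None => None
  end.

Lemma le_min_option o1 o2 x :
  le_option (min_option o1 o2) x = le_option o1 x && le_option o2 x.
Proof.
case: o1 o2 => [q1|] [q2|] //=; last by rewrite andbT.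
by rewrite minElt; case: ltP => q12; apply/idP/andP => [xq|[]//]; split => //;
  apply: (le_trans xq); rewrite ler_rat// ltW.
Qed.

Lemma rational_boxE q : range rational_boxes (rational_box q).
Proof. by exists (pickle q) => //; rewrite /rational_boxes pickleK. Qed.

Lemma rational_boxesT : range rational_boxes setT.
Proof.
have [q <-] : exists q, rational_box q = setT.
  exists [tuple None | j < n]; apply/seteqP; split => // t _ j.
  by rewrite tnth_mktuple.
exact: rational_boxE.
Qed.

Lemma rational_boxesI : setI_closed (range rational_boxes).
Proof.
move=> _ _ [k1 _ <-] [k2 _ <-]; rewrite /rational_boxes.
case: (unpickle k1) => [q1|]; case: (unpickle k2) => [q2|];
  rewrite ?setTI ?setIT; [|exact: rational_boxE..|exact: rational_boxesT].
rewrite (_ : _ `&` _ =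
    rational_box [tuple min_option (tnth q1 j) (tnth q2 j) | j < n]).
  exact: rational_boxE.
apply/seteqP; split => [t [t1 t2] j|t t12].
  by rewrite tnth_mktuple le_min_option t1 t2.
by split=> j; have := t12 j; rewrite tnth_mktuple le_min_option => /andP[].
Qed.

Lemma measurable_rational_boxes k : measurable (rational_boxes k).
Proof.
rewrite /rational_boxes; case: unpickle => [q|//].
rewrite (_ : rational_box q =
    \bigcap_(j in [set: 'I_n])
      [set t | le_option (tnth q j) (tnth t j)]); last first.
  by apply/seteqP; split => [t tq j _|t tq j]; exact: tq.
apply: fin_bigcap_measurable => // j _; case: (tnth q j) => [r|] /=.
  rewrite -[X in measurable X]setTI; apply: measurable_fun_ler => //.
  exact: measurable_tnth.
by rewrite [X in measurable X](_ : _ = setT)//; apply/seteqP; split.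
Qed.

(** It suffices that the identity, from the sigma-algebra generated by the
    boxes to tuples, has measurable coordinates; a half-line below [x] is the
    countable union of the half-lines below the rationals less than [x]. *)
Lemma measurable_rational_boxesE :
  @measurable _ (n.-tuple R) = <<s range rational_boxes >>.
Proof.
apply/seteqP; split; last first.
  apply: smallest_sub; first exact: sigma_algebra_measurable.
  by move=> _ [k _ <-]; exact: measurable_rational_boxes.
move=> B mB.
pose T' := g_sigma_algebraType (range rational_boxes).
suff mid : measurable_fun [set: T'] (idfun : T' -> n.-tuple R).
  by have := mid measurableT B mB; rewrite setTI.
apply/measurable_fun_tnthP => j.
have RE : @measurable _ R = <<s @RGenInftyO.G R >>.
  exact: RGenInftyO.measurableE.
refine (@measurability _ _ _ _ _ _ _ RE _).
move=> _ [_ [x ->] <-]; rewrite setTI.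
pose box (q : rat) := if ratr q < x then
  rational_box [tuple if i == j then Some q else None | i < n] else set0.
rewrite (_ : _ @^-1` _ = \bigcup_q box q); last first.
  apply/seteqP; split => [t /=|t [q _]].
    rewrite in_itv/= => /rat_in_itvoo[q]; rewrite in_itv/= => /andP[tq qx].
    exists q => //; rewrite /box qx => i; rewrite tnth_mktuple.
    by case: eqVneq => // ->; exact: ltW.
  rewrite /box; case: ifPn => // qx /(_ j); rewrite tnth_mktuple eqxx/= in_itv/=.
  by move=> tq; exact: le_lt_trans qx.
apply: bigcupT_measurable_rat => q; rewrite /box; case: ifP => // _.
by apply: sub_sigma_algebra; exact: rational_boxE.
Qed.

End rational_box.

Lemma conditional_law_integral d d1 d2 (Omega : measurableType d)
    (T1 : measurableType d1) (T2 : measurableType d2) (R : realType)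
    (P : probability Omega R) (X : {RV P >-> T1}) (k : R.-pker T1 ~> T2) A B :
  measurable A -> measurable B ->
  (\int[P]_(w in X @^-1` A) k (X w) B =
   \int[distribution P X]_(t in A) k t B)%E.
Proof.
move=> mA mB; rewrite ge0_integral_pushforward//.
by apply: measurable_funTS; exact: measurable_kernel.
Qed.

(** A conditional law is determined up to a null set that depends on the event.
    Countably many null sets suffice when a countable pi-system generates the
    sigma-algebra, because probability measures that agree on it are equal. *)
Lemma conditional_law_unique d d1 d2 (Omega : measurableType d)
    (T1 : measurableType d1) (T2 : measurableType d2) (R : realType)
    (P : probability Omega R) (X : {RV P >-> T1}) (Y : {RV P >-> T2})
    (G : nat -> set T2) (k k' : R.-pker T1 ~> T2) :
  @measurable _ T2 = <<s range G >> -> setI_closed (range G) ->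
  range G setT ->
  conditional_law P X Y (fun t => k t) ->
  conditional_law P X Y (fun t => k' t) ->
  {ae distribution P X, forall t, forall B, measurable B -> k t B = k' t B}.
Proof.
move=> GE GI GT kl k'l.
have mG i : measurable (G i) by rewrite GE; apply: sub_sigma_algebra; exists i.
have aeG i : {ae distribution P X, forall t, k t (G i) = k' t (G i)}.
  have : ae_eq (distribution P X) setT (k ^~ (G i)) (k' ^~ (G i)).
    apply: integral_ae_eq => //.
    - apply/integrableP; split; first exact: measurable_kernel.
      under eq_integral do rewrite gee0_abs//.
      rewrite -conditional_law_integral// -kl//.
      rewrite preimage_setT setTI ltey_eq fin_num_measure//.
      exact: measurable_preimage.
    - exact: measurable_kernel.
    - move=> A _ mA; rewrite -!conditional_law_integral//.
      by rewrite -kl// -k'l.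
  by apply: filterS => t; apply.
have /ae_foralln := aeG.
apply: filterS => t tG B mB.
apply: (measure_unique (range G) (fun _ => setT)) => //.
- by rewrite bigcup_const.
- by move=> _ [i _ <-]; exact: tG.
- by move=> _; rewrite prob_kernel ltry.
Qed.

(** * The normalized posterior *)

(** Since [0 * +oo = 0], finiteness of the product alone would not bound the
    factors; its positivity excludes vanishing factors. *)
Lemma fin_num_factor (R : realType) n (Z : 'I_n -> \bar R) :
  (forall j, 0 <= Z j)%E -> (0 < \prod_(j < n) Z j < +oo)%E ->
  forall j, Z j \is a fin_num.
Proof.
elim: n Z => [|n IHn] Z Z0 + j; first by case: j.
rewrite big_ord_recl; set x := Z ord0.
set y := (\prod_(i < n) _)%E => /andP[xy0 xyoo].
have y0 : (0 <= y)%E by exact: prode_ge0.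
have xN0 : (0 < x)%E.
  by rewrite lt0e Z0 andbT; apply: contraTneq xy0 => ->; rewrite mul0e ltxx.
have yN0 : (0 < y)%E.
  by rewrite lt0e y0 andbT; apply: contraTneq xy0 => ->; rewrite mule0 ltxx.
have xfin : x \is a fin_num.
  rewrite ge0_fin_numE ?Z0// ltey; apply: contraTneq xyoo => ->.
  by rewrite gt0_mulye.
have yfin : (0 < y < +oo)%E.
  rewrite yN0 ltey; apply: contraTneq xyoo => ->.
  by rewrite gt0_muley.
case: (unliftP ord0 j) => [i|] -> //.
by apply: (IHn (fun i => Z (lift ord0 i))).
Qed.

Section posterior_kernel.
Local Open Scope ereal_scope.
Context {R : realType} (n : nat) (a : R).
Local Notation leb := (lebesgue_tuple R).

Lemma giG_mass_measure_sig (t : n.-tuple R) :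
  {M : {measure set (n.-tuple R) -> \bar R} |
    (M : set (n.-tuple R) -> \bar R) = giG_mass a t}.
Proof.
have mq : measurable_fun setT (fun T => (giG_prod a (t, T))%:E).
  apply/measurable_EFinP.
  exact: (measurableT_comp (measurable_giG_prod a) (pair1_measurable t)).
have q0 T : 0 <= (giG_prod a (t, T))%:E by rewrite lee_fin giG_prod_ge0.
have [M ME] := density_measure_of (leb n) mq q0.
have [N NE] := pushforward_measure_of M (@measurable_normalize R n).
by exists N; rewrite NE /pushforward ME.
Qed.

Definition giG_mass_measure (t : n.-tuple R) :
    {measure set (n.-tuple R) -> \bar R} :=
  sval (giG_mass_measure_sig t).

Lemma giG_mass_measureE (t : n.-tuple R) B :
  giG_mass_measure t B = giG_mass a t B.
Proof. by rewrite /giG_mass_measure; case: giG_mass_measure_sig => M /= ->. Qed.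

Lemma measurable_giG_mass (B : set (n.-tuple R)) : measurable B ->
  measurable_fun setT (fun t : n.-tuple R => giG_mass a t B).
Proof.
move=> mB.
have mNB : measurable (@normalize R n @^-1` B).
  by apply: measurable_preimage => //; exact: measurable_normalize.
have mSNB := measurableX (@measurableT _ (n.-tuple R)) mNB.
pose f := (fun z : n.-tuple R * n.-tuple R => (giG_prod a z)%:E) \_
  (setT `*` (@normalize R n @^-1` B)).
have mf : measurable_fun setT f.
  apply/(measurable_restrictT _ mSNB); apply: measurable_funTS.
  by apply/measurable_EFinP; exact: measurable_giG_prod.
rewrite (_ : (fun t : n.-tuple R => giG_mass a t B) =
    fun t => \int[leb n]_T f (t, T)).
  apply: (measurable_fun_fubini_tonelli_F (m2 := leb n)) => // z.
  by rewrite /f patchE; case: ifP => // _; rewrite lee_fin giG_prod_ge0.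
apply/funext => t; rewrite /giG_mass integral_mkcond.
apply: eq_integral => T _; rewrite /f !patchE.
by congr (if _ then _ else _); apply/idP/idP; rewrite !inE; [|case].
Qed.

Let measurable_giG_mass_measure B : measurable B ->
  measurable_fun setT (giG_mass_measure ^~ B).
Proof.
move=> mB.
rewrite (_ : (fun t => _) = (fun t : n.-tuple R => giG_mass a t B)).
  exact: measurable_giG_mass.
by apply/funext => t; rewrite giG_mass_measureE.
Qed.

HB.instance Definition _ := isKernel.Build _ _ _ _ R giG_mass_measure
  measurable_giG_mass_measure.

(** Where the total mass is 0 or infinite the kernel is an arbitrary Dirac
    measure; [theta] almost surely avoids these points. *)
Definition posterior_kernel : R.-pker (n.-tuple R) ~> (n.-tuple R) :=
  knormalize giG_mass_measure point.

Lemma posterior_kernelE (t : n.-tuple R) B : 0 < giG_mass a t setT < +oo ->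
  posterior_kernel t B = giG_mass a t B * (fine (giG_mass a t setT))^-1%:E.
Proof.
move=> /andP[t0 too].
rewrite /posterior_kernel /knormalize/= /mnormalize giG_mass_measureE.
by rewrite gt_eqF// lt_eqF//= giG_mass_measureE.
Qed.

Lemma giGE (t : R) (A : set R) : giG (a - 1) 1 (2 * `|t|) A =
  \int[lebesgue_measure]_(x in A)
    (giG_kernel (a - 1) 1 (t, x) /
     fine (\int[lebR]_y (giG_kernel (a - 1) 1 (t, y))%:E))%:E.
Proof.
have kE (x : R) : (`]0%R, +oo[%classic : set R) x ->
    giG_kernel (a - 1) 1 (t, x) = giG_weight (a - 1) 1 (2 * `|t|) x.
  by rewrite /giG_kernel/= in_itv/= andbT => ->.
have kN (x : R) : ~ (`]0%R, +oo[%classic : set R) x ->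
    giG_kernel (a - 1) 1 (t, x) = 0%R.
  by rewrite /giG_kernel/= in_itv/= andbT => /negP/negbTE ->.
have mk : measurable_fun setT (fun y => (giG_kernel (a - 1) 1 (t, y))%:E).
  apply/measurable_EFinP.
  exact: (measurableT_comp (measurable_giG_kernel _ _) (pair1_measurable _)).
have -> : \int[lebR]_y (giG_kernel (a - 1) 1 (t, y))%:E =
    \int[lebesgue_measure]_(y in `]0%R, +oo[)
      (giG_weight (a - 1) 1 (2 * `|t|) y)%:E.
  rewrite integral_lebR//; last by move=> y _; rewrite lee_fin giG_kernel_ge0.
  rewrite [RHS]integral_mkcond; apply: eq_integral => y _; rewrite patchE.
  by case: ifPn; rewrite ?inE ?notin_setE => yI; [rewrite kE|rewrite kN].
rewrite /giG /Rintegral integral_mkcondr; apply: eq_integral => y _.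
rewrite patchE; case: ifPn; rewrite ?inE ?notin_setE => yI; first by rewrite kE.
by rewrite kN// mul0r.
Qed.

(** The hypothesis on the total mass makes every one-dimensional normalizing
    integral finite, so the constants in [giG] are the true ones and multiply
    to the total mass. *)
Lemma normalized_giG_lawE (t : n.-tuple R) B :
  measurable B -> 0 < giG_mass a t setT < +oo ->
  normalized_giG_law a t B = posterior_kernel t B.
Proof.
move=> mB t0; rewrite posterior_kernelE//.
pose Z j := \int[lebR]_x (giG_kernel (a - 1) 1 (tnth t j, x))%:E.
have mk j : measurable_fun setT (fun x => giG_kernel (a - 1) 1 (tnth t j, x)).
  exact: (measurableT_comp (measurable_giG_kernel _ _) (pair1_measurable _)).
have Z0 j : 0 <= Z j.
  by apply: integral_ge0 => x _; rewrite lee_fin giG_kernel_ge0.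
have massE : giG_mass a t setT = \prod_(j < n) Z j.
  rewrite /giG_mass preimage_setT.
  rewrite (integral_prod_tuple
    (g := fun j x => giG_kernel (a - 1) 1 (tnth t j, x)))//.
  by move=> j x; exact: giG_kernel_ge0.
have Zfin j : Z j \is a fin_num.
  by apply: fin_num_factor => //; rewrite -massE.
have fmassE : fine (giG_mass a t setT) = (\prod_(j < n) fine (Z j))%R.
  rewrite massE; under eq_bigr => j _ do rewrite -(fineK (Zfin j)).
  by rewrite -(big_morph EFin (@EFinM R) (erefl : (1%R : R)%:E = 1)).
rewrite /normalized_giG_law /pushforward.
rewrite (_ : (fun j => giG _ _ _) = (fun j (A : set R) =>
    \int[lebesgue_measure]_(x in A)
      (giG_kernel (a - 1) 1 (tnth t j, x) / fine (Z j))%:E)); last first.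
  by apply/funext => j; apply/funext => A; exact: giGE.
rewrite (tuple_product_density
  (g := fun j x => giG_kernel (a - 1) 1 (tnth t j, x) / fine (Z j))%R);
  last 3 first.
- by move=> j; exact: measurable_funM.
- by move=> j x; rewrite divr_ge0 ?giG_kernel_ge0 ?fine_ge0//; exact: Z0.
- by apply: measurable_preimage => //; exact: measurable_normalize.
rewrite /giG_mass fmassE -ge0_integralZr//; last 4 first.
- by apply: measurable_preimage => //; exact: measurable_normalize.
- apply: measurable_funTS; apply/measurable_EFinP.
  exact: (measurableT_comp (measurable_giG_prod a) (pair1_measurable t)).
- by move=> T _; rewrite lee_fin giG_prod_ge0.
- by rewrite lee_fin invr_ge0 prodr_ge0// => j _; rewrite fine_ge0.
apply: eq_integral => T _; rewrite -EFinM; congr EFin.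
by rewrite big_split/= prodfV.
Qed.

End posterior_kernel.

(** * The conditional law of phi given theta *)

Theorem theorem2p2 (R : realType) (n : nat) (a : R)
    (d : measure_display) (Omega : measurableType d) (P : probability Omega R)
    (theta phi : {RV P >-> n.-tuple R}) (tau : {RV P >-> R})
    (hn : (2 <= n)%N) (ha : 0 < a)
    (hphi : has_law P phi (@symmetric_Dirichlet R n a))
    (htau : has_law P tau (gamma_law (n%:R * a) 2^-1))
    (hind : independent_pair P phi tau)
    (htheta : conditional_law P (fun w => (phi w, tau w)) theta
       (fun u => tuple_product
          (fun j : 'I_n => double_exponential (tnth u.1 j * u.2)))) :
  (exists k : R.-pker (n.-tuple R) ~> (n.-tuple R),
     conditional_law P theta phi (fun t => k t)) /\
  (forall k : R.-pker (n.-tuple R) ~> (n.-tuple R),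
     conditional_law P theta phi (fun t => k t) ->
     {ae distribution P theta, forall t : n.-tuple R,
        forall B : set (n.-tuple R), measurable B ->
          k t B = normalized_giG_law a t B}).
Proof.
case: n => [//|m] in theta phi hn hphi htau hind htheta *.
pose C := posterior_const m a.
(* The marginal density of theta. *)
pose ev (t : m.+1.-tuple R) : \bar R := (C%:E * giG_mass a t setT)%E.
have C0 : 0 <= C by exact: posterior_const_ge0.
have joint A B : measurable A -> measurable B ->
    (P (theta @^-1` A `&` phi @^-1` B) =
     \int[lebesgue_tuple R m.+1]_(t in A) (C%:E * giG_mass a t B))%E.
  by move=> mA mB; have := joint_law hphi htau hind htheta mA mB; apply.
have mass0 (t : m.+1.-tuple R) B : (0 <= giG_mass a t B)%E.
  by rewrite -giG_mass_measureE.
have massT (t : m.+1.-tuple R) B : measurable B ->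
    (giG_mass a t B <= giG_mass a t setT)%E.
  by move=> mB; rewrite -!giG_mass_measureE le_measure ?inE.
have mev : measurable_fun setT ev.
  by apply: measurable_funeM; exact: measurable_giG_mass.
have ev0 t : (0 <= ev t)%E by rewrite mule_ge0// lee_fin.
have ev_mass t : ev t != 0%E -> (ev t < +oo)%E ->
    (0 < C) /\ (0 < giG_mass a t setT < +oo)%E.
  rewrite /ev => evN0 evoo.
  have Cgt0 : 0 < C.
    rewrite lt_neqAle C0 andbT; apply: contra_neq evN0 => <-.
    by rewrite mul0e.
  split => //; rewrite lt0e mass0 andbT; apply/andP; split.
    by apply: contra_neq evN0 => ->; rewrite mule0.
  rewrite ltey; apply: contraTneq evoo => ->.
  by rewrite gt0_muley.
have marginal A : measurable A ->
    (distribution P theta A = \int[lebesgue_tuple R m.+1]_(t in A) ev t)%E.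
  by move=> mA; rewrite -joint// preimage_setT setIT.
have evfin : {ae lebesgue_tuple R m.+1, forall t, (ev t < +oo)%E}.
  have iev : (lebesgue_tuple R m.+1).-integrable setT ev.
    apply/integrableP; split => //.
    under eq_integral do rewrite gee0_abs//.
    by rewrite -marginal// probability_setT ltry.
  have := integrable_ae measurableT iev.
  by apply: filterS => t /(_ Logic.I); rewrite ge0_fin_numE.
have post_law :
    conditional_law P theta phi (fun t => posterior_kernel m.+1 a t).
  move=> A B mA mB; rewrite joint// conditional_law_integral//.
  have mk : measurable_fun setT ((fun t => posterior_kernel m.+1 a t B) \_ A).
    apply/(measurable_restrictT _ mA); apply: measurable_funTS.
    exact: measurable_kernel.
  have k0 t : (0 <= ((fun t => posterior_kernel m.+1 a t B) \_ A) t)%E.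
    by rewrite patchE; case: ifP.
  rewrite [RHS]integral_mkcond
    (ge0_integral_density (m := lebesgue_tuple R m.+1) (g := ev))//.
  rewrite [LHS]integral_mkcond; apply: ge0_ae_eq_integral => //.
  - apply/(measurable_restrictT _ mA); apply: measurable_funTS.
    by apply: measurable_funeM; exact: measurable_giG_mass.
  - exact: emeasurable_funM.
  - by move=> t _; rewrite patchE; case: ifP => // _; rewrite mule_ge0// lee_fin.
  - by move=> t _; rewrite mule_ge0.
  - apply: filterS evfin => t evt _.
    rewrite !patchE; case: ifP => _; last by rewrite mul0e.
    (* Where [ev] vanishes, so does the smaller mass of [B]. *)
    have [t0|t0] := eqVneq (ev t) 0%E.
      rewrite t0 mule0; apply/eqP; rewrite eq_le mule_ge0 ?lee_fin// andbT.
      by rewrite -t0 /ev lee_wpmul2l// ?lee_fin// massT.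
    have [Cgt0 /[dup] mT /andP[mT0 mToo]] := ev_mass _ t0 evt.
    have mTfin : giG_mass a t setT \is a fin_num by rewrite ge0_fin_numE.
    have mBfin : giG_mass a t B \is a fin_num.
      by rewrite ge0_fin_numE//; exact: le_lt_trans (massT _ _ mB) mToo.
    rewrite posterior_kernelE// /ev -(fineK mTfin) -(fineK mBfin) /= -!EFinM.
    congr EFin; field.
    by rewrite fine_eq0// gt_eqF.
split; first by exists (posterior_kernel m.+1 a).
move=> k kl.
have kpost := conditional_law_unique (measurable_rational_boxesE m.+1)
  (@rational_boxesI R m.+1) (@rational_boxesT R m.+1) kl post_law.
have good : {ae distribution P theta, forall t, (0 < giG_mass a t setT < +oo)%E}.
  (* [ev] vanishes almost everywhere on [E], since it is almost everywhere
     finite; so theta almost surely avoids [E]. *)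
  pose E := [set t | ev t = 0%E] `|` [set t | ev t = +oo%E].
  have mE : measurable E.
    by apply: measurableU; exact: measurable_preimage mev (emeasurable_set1 _).
  exists E; split => //.
    rewrite marginal// (@ge0_ae_eq_integral _ _ _ _ E _ (cst 0%E))//.
    - by rewrite integral0.
    - exact: measurable_funTS.
    - apply: filterS evfin => t evt [//|/= evoo].
      by rewrite evoo in evt.
  move=> t /= tN; apply: contrapT => /not_orP[/eqP t0 tT].
  apply: tN; apply: (ev_mass t t0 _).2.
  by rewrite ltey; exact/eqP.
apply: filterS2 good kpost => t t0 kt B mB.
by rewrite kt// normalized_giG_lawE.
Qed.
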